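(* Let $\nu$ be a symmetric Lévy measure on $\mathbb{R}^d$ with $\nu(\mathbb{R}^d)=\infty$, and assume that there is a constant $M_0>0$ such that $$\int_{\mathbb{R}^d} e^{-t\Phi(\xi)}|\xi|\,d\xi\le M_0\,h(t)^{-d-1}\qquad\text{for all } t\in(0,\infty).$$ Then there exist positive constants $c_1,c_2,c_3,c_4$ (depending on $\nu$) such that $$p_t(x)\ge c_1\,h(t)^{-d}\,e^{-c_2|x|^2/t}\qquad\text{for all } t>c_3 \text{ and } x\in\mathbb{R}^d \text{ with } |x|\le c_4t,$$ where $p_t$ is the density of $P_t$.
   Context: $d\in\{1,2,\dots\}$. A symmetric Lévy measure on $\mathbb{R}^d$ is a Borel measure $\nu$ with $\nu(\{0\})=0$, $\int(1\wedge|y|^2)\,\nu(dy)<\infty$ and $\nu(-D)=\nu(D)$ for all Borel $D\subset\mathbb{R}^d$. Put $\Phi(\xi)=\int_{\mathbb{R}^d}(1-\cos(\xi\cdot y))\,\nu(dy)$, $\xi\in\mathbb{R}^d$. $\{P_t\}_{t\ge0}$ is the convolution semigroup of probability measures on $\mathbb{R}^d$ with $\int e^{i\xi\cdot y}P_t(dy)=e^{-t\Phi(\xi)}$. Put $\Psi(r)=\sup_{|\xi|\le r}\Phi(\xi)$ for $r>0$; since $\nu(\mathbb{R}^d)=\infty$, $\Psi$ is continuous, nondecreasing and unbounded. Put $\Psi^{-1}(s)=\sup\{r>0:\Psi(r)=s\}$ for $s>0$ and $h(t)=1/\Psi^{-1}(1/t)$ for $t>0$. Under the integral assumption in the claim each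 $P_t$, $t>0$, has a continuous density $p_t$ with respect to Lebesgue measure; $p_t$ denotes this version. *)

(* Defs.v *)
From HB Require Import structures.
From mathcomp Require Import all_boot all_order all_algebra.
From mathcomp Require Import all_classical all_reals all_analysis.
From mathcomp Require Import measurable_realfun complex.

Set Implicit Arguments.
Unset Strict Implicit.
Unset Printing Implicit Defensive.
Import Order.TTheory GRing.Theory Num.Theory.
Import numFieldNormedType.Exports.

Local Open Scope classical_set_scope.
Local Open Scope ring_scope.
Local Open Scope complex_scope.

HB.instance Definition _ (R : realType) (m n : nat) :=
  Measurable.copy 'M[R]_(m, n) (g_sigma_algebraType (@open 'M[R]_(m, n))).

Section borel_matrix.
Context {R : realType} {m n : nat}.

Lemma open_measurable_mx (U : set 'M[R]_(m, n)) : open U -> measurable U.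
Proof. exact: sub_sigma_algebra. Qed.

Lemma measurable_coord (i : 'I_m) (j : 'I_n) :
  measurable_fun [set: 'M[R]_(m, n)] (fun M => M i j).
Proof.
apply: (measurability _ (RGenOpens.measurableE R)) => _ [_ [a [b ->] <-]].
rewrite setTI; apply: open_measurable_mx.
by apply: open_comp => [M _|]; [exact: coord_continuous|exact: interval_open].
Qed.

Lemma measurable_fun_mx d (T : measurableType d) (f : T -> 'M[R]_(m, n)) :
  (forall i j, measurable_fun [set: T] (fun t => f t i j)) ->
  measurable_fun [set: T] f.
Proof.
move=> mf; apply: (@measurability _ _ _ _ setT f (@open 'M[R]_(m, n))) => //.
move=> _ [U oU <-]; rewrite setTI.
pose B (q : 'M[rat]_(m, n) * nat) : set 'M[R]_(m, n) :=
  [set M | forall i j, `|ratr (q.1 i j) - M i j| < q.2.+1%:R^-1].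
have -> : U = \bigcup_q [set M | B q `<=` U /\ B q M].
  apply/seteqP; split=> [M UM|M [q _ [+ ?]]]; last exact.
  have /nbhs_ballP[e /= e0 eU] : nbhs M U by exact: open_nbhs_nbhs.
  have [k ke] : exists k, k.+1%:R^-1 < e / 2.
    have [k _ /(_ k (leqnn k)) ke] := near_infty_natSinv_lt (PosNum (divr_gt0 e0 (@ltr0n R 2))).
    by exists k.
  have qM i j : {q : rat | `|ratr q - M i j| < k.+1%:R^-1}.
    apply: cid; have k0 : (0 : R) < k.+1%:R^-1 by rewrite invr_gt0.
    have : M i j - k.+1%:R^-1 < M i j + k.+1%:R^-1 by rewrite ltrD2l gtrN.
    move=> /rat_in_itvoo[q]; rewrite in_itv/= => q_; exists q.
    by rewrite ltr_distl.
  exists (\matrix_(i, j) sval (qM i j), k) => //=; split=> [N BN|i j].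
    apply: eU; split=> // i j; rewrite /ball/=.
    have := BN i j; rewrite mxE /= => Nq.
    rewrite (splitr e) (le_lt_trans (ler_distD (ratr (sval (qM i j))) _ _))//.
    rewrite ltrD// ?(lt_trans Nq)// distrC.
    by rewrite (lt_trans (svalP (qM i j))).
  by rewrite mxE; exact: (svalP (qM i j)).
rewrite preimage_bigcup; apply: countable_bigcupT_measurable => // q.
have [BU|nBU] := pselect (B q `<=` U); last first.
  by rewrite (_ : _ @^-1` _ = set0)//; apply/seteqP; split=> t // -[].
rewrite (_ : _ @^-1` _ = f @^-1` B q); last first.
  by apply/seteqP; split=> t //= [].
have -> : f @^-1` B q = \bigcap_(ij in [set: 'I_m * 'I_n])
    (fun t => f t ij.1 ij.2) @^-1` ball (ratr (q.1 ij.1 ij.2) : R) q.2.+1%:R^-1.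
  apply/seteqP; split=> t; first by move=> Bt [i j] _; exact: Bt.
  by move=> Bt i j; exact: (Bt (i, j)).
apply: fin_bigcap_measurable => // -[i j] _.
rewrite -[X in measurable X]setTI; apply: mf => //.
by apply: open_measurable; exact: ball_open.
Qed.

End borel_matrix.

Section lebesgue_rV_succ.
Context {R : realType} {n : nat}.
Variable mu : {sigma_finite_measure set 'rV[R]_n -> \bar R}.

Definition cons_rV (p : R * 'rV[R]_n) : 'rV[R]_n.+1 :=
  row_mx (const_mx p.1 : 'rV[R]_1) p.2.

Definition uncons_rV (v : 'rV[R]_n.+1) : R * 'rV[R]_n :=
  (v 0 0, rsubmx (v : 'rV[R]_(1 + n))).

Lemma uncons_rVK : cancel uncons_rV cons_rV.
Proof.
move=> v; rewrite /cons_rV /= -[RHS](@hsubmxK _ 1 1 n v).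
congr (@row_mx _ 1 1 n _ _).
by apply/rowP => i; rewrite !mxE !ord1; congr (v _ _); exact/val_inj.
Qed.

Lemma cons_rVK : cancel cons_rV uncons_rV.
Proof.
move=> [a v]; rewrite /uncons_rV /cons_rV /= row_mxKr; congr pair.
have -> : (0 : 'I_n.+1) = @lshift 1 n 0 by exact/val_inj.
by apply: eq_trans (@row_mxEl _ 1 1 n _ _ _ _) _; rewrite mxE.
Qed.

Lemma measurable_cons_rV :
  measurable_fun [set: measurableTypeR R * 'rV[R]_n] cons_rV.
Proof.
apply: measurable_fun_mx => i j.
have [k ->|k ->] := @split_ordP 1 n j.
- rewrite (_ : (fun _ => _) = fst); first exact: measurable_fst.
  apply/funext => -[a v]; apply: eq_trans (@row_mxEl _ 1 1 n _ _ _ _) _.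
  by rewrite mxE.
- rewrite (_ : (fun _ => _) = (fun v : 'rV[R]_n => v i k) \o snd).
    by apply: measurableT_comp; [exact: measurable_coord|exact: measurable_snd].
  by apply/funext => -[a v]; exact: (@row_mxEr _ 1 1 n).
Qed.

Lemma measurable_uncons_rV :
  measurable_fun [set: 'rV[R]_n.+1]
    (uncons_rV : _ -> measurableTypeR R * 'rV[R]_n).
Proof.
apply/measurable_fun_pairP; split; first exact: measurable_coord.
apply: measurable_fun_mx => i j.
rewrite (_ : (fun _ => _) =
  (fun v : 'rV[R]_n.+1 => v i (@rshift 1 n j))); first exact: measurable_coord.
by apply/funext => v; rewrite /= mxE.
Qed.

Definition lebesgue_rVS : set 'rV[R]_n.+1 -> \bar R :=
  pushforward (@lebesgue_measure R \x mu)%E cons_rV.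

Let lebesgue_rVS0 : lebesgue_rVS set0 = 0%E.
Proof. by rewrite /lebesgue_rVS /pushforward preimage_set0 measure0. Qed.

Let lebesgue_rVS_ge0 A : (0 <= lebesgue_rVS A)%E.
Proof. by rewrite /lebesgue_rVS /pushforward measure_ge0. Qed.

Let lebesgue_rVS_sigma_additive : semi_sigma_additive lebesgue_rVS.
Proof.
move=> F mF tF mUF; rewrite /lebesgue_rVS /pushforward preimage_bigcup.
have mX A : measurable A -> measurable (cons_rV @^-1` A).
  by move=> mA; rewrite -[X in measurable X]setTI; exact: measurable_cons_rV.
apply: measure_semi_sigma_additive.
- by move=> k; exact: mX.
- apply/trivIsetP => /= i j _ _ ij; rewrite -preimage_setI.
  by move/trivIsetP : tF => /(_ _ _ _ _ ij) ->//; rewrite preimage_set0.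
- by rewrite -preimage_bigcup; exact: mX.
Qed.

HB.instance Definition _ := isMeasure.Build _ _ _ lebesgue_rVS
  lebesgue_rVS0 lebesgue_rVS_ge0 lebesgue_rVS_sigma_additive.

Let lebesgue_rVS_sigma_finite : sigma_finite setT lebesgue_rVS.
Proof.
have /sigma_finiteP[F [TF ndF Foo]] := sigma_finiteT (@lebesgue_measure R).
have /sigma_finiteP[G [TG ndG Goo]] := sigma_finiteT mu.
exists (fun k => uncons_rV @^-1` (F k `*` G k)).
  rewrite -preimage_bigcup (_ : \bigcup_k (F k `*` G k) = setT)//.
  rewrite -setXTT TF TG; apply/seteqP; split=> [[x y] [k _ [/= Fx Gy]]|[x y]].
    by split; exists k.
  move=> [/= [i _ Fx] [j _ Gy]]; exists (maxn i j) => //; split => /=.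
  - by move: Fx; exact/subsetPset/ndF/leq_maxl.
  - by move: Gy; exact/subsetPset/ndG/leq_maxr.
move=> k; have [mF Fk] := Foo k; have [mG Gk] := Goo k.
split.
  rewrite -[X in measurable X]setTI; apply: measurable_uncons_rV => //.
  exact: measurableX.
rewrite /lebesgue_rVS /pushforward -comp_preimage.
rewrite (_ : _ \o _ = id); last by apply/funext => p /=; exact: cons_rVK.
by rewrite preimage_id product_measure1E// lte_mul_pinfty// ge0_fin_numE.
Qed.

HB.instance Definition _ := Measure_isSigmaFinite.Build _ _ _ lebesgue_rVS
  lebesgue_rVS_sigma_finite.

End lebesgue_rV_succ.

Fixpoint lebesgue_rV (R : realType) (n : nat) :
    {sigma_finite_measure set 'rV[R]_n -> \bar R} :=
  match n with
  | 0 => \d_(0 : 'rV[R]_0)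
  | n'.+1 => lebesgue_rVS (lebesgue_rV R n')
  end.

Lemma lebesgue_rV_box (R : realType) (n : nat) (a b : 'rV[R]_n) :
  (forall i, a 0 i <= b 0 i) ->
  lebesgue_rV R n [set v : 'rV[R]_n | forall i, v 0 i \in `[a 0 i, b 0 i]] =
  (\prod_(i < n) (b 0 i - a 0 i))%:E.
Proof.
elim: n => [|n IHn] in a b * => ab.
  by rewrite big_ord0 /= diracE mem_set//= => -[].
pose tl (v : 'rV[R]_n.+1) : 'rV[R]_n := (uncons_rV v).2.
have tlE v i : tl v 0 i = v 0 (lift ord0 i).
  by rewrite /tl /= mxE; congr (v _ _); exact/val_inj.
rewrite /= /lebesgue_rVS /pushforward.
set A := _ @^-1` _.
have -> : A = `[a 0 0, b 0 0]%classic `*`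
    [set v : 'rV[R]_n | forall i, v 0 i \in `[tl a 0 i, tl b 0 i]].
  have c0 (x : R) (v : 'rV[R]_n) : cons_rV (x, v) 0 0 = x.
    by have /(congr1 fst) := cons_rVK (x, v).
  have cl (x : R) (v : 'rV[R]_n) i : cons_rV (x, v) 0 (lift ord0 i) = v 0 i.
    by have := tlE (cons_rV (x, v)) i; rewrite /tl cons_rVK => <-.
  apply/seteqP; split => [[x v] /= Axv|[x v] /= [x0 vl] i].
    split=> [|i] /=; first by have := Axv 0; rewrite c0.
    by have := Axv (lift ord0 i); rewrite cl !tlE.
  have [j ->|->] := unliftP ord0 i; last by rewrite c0.
  by rewrite cl -!tlE; exact: vl.
rewrite product_measure1E//; last first.
  rewrite (_ : [set v | _] = \bigcap_(i in [set: 'I_n])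
    (fun v : 'rV[R]_n => v 0 i) @^-1` `[tl a 0 i, tl b 0 i]%classic); last first.
    by apply/seteqP; split=> v vP i *; exact: vP.
  apply: fin_bigcap_measurable => // i _.
  by rewrite -[X in measurable X]setTI; exact: measurable_coord.
rewrite IHn => [|i]; last by rewrite !tlE.
rewrite [X in (X * _)%E](_ : _ = (b 0 0 - a 0 0)%:E); last first.
  apply: eq_trans (lebesgue_measure_itv `[a 0 0, b 0 0]) _.
  rewrite /= lte_fin -EFinB; case: ltP => // ba.
  by congr EFin; apply/esym/eqP; rewrite subr_eq0 eq_le ba ab.
rewrite -EFinM big_ord_recl; congr (_ * _)%:E.
by apply: eq_bigr => i _; rewrite !tlE.
Qed.

Section euclidean.
Context {R : realType} {d : nat}.
Implicit Types x y : 'rV[R]_d.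

Definition dotp x y : R := \sum_(i < d) x 0 i * y 0 i.

(* The library's norm `|x| on 'rV[R]_d is the sup norm. *)
Definition enorm x : R := Num.sqrt (dotp x x).

End euclidean.

Section levy.
Context {R : realType} {d : nat}.

Record symmetric_levy_measure (nu : {measure set 'rV[R]_d -> \bar R}) : Prop :=
  SymmetricLevyMeasure {
    levy_set0 : nu [set 0] = 0%E;
    levy_integral_lty : (\int[nu]_y (Num.min 1 (enorm y ^+ 2))%:E < +oo)%E;
    levy_sym : forall D : set 'rV[R]_d, measurable D ->
      nu [set - y | y in D] = nu D }.

Definition levy_exponent (nu : {measure set 'rV[R]_d -> \bar R})
    (xi : 'rV[R]_d) : R :=
  \int[nu]_y (1 - cos (dotp xi y)).

Definition levy_Psi (nu : {measure set 'rV[R]_d -> \bar R}) (r : R) : R :=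
  sup [set levy_exponent nu xi | xi in [set xi | enorm xi <= r]].

Definition levy_Psi_inv (nu : {measure set 'rV[R]_d -> \bar R}) (s : R) : R :=
  sup [set r | 0 < r /\ levy_Psi nu r = s].

Definition levy_h (nu : {measure set 'rV[R]_d -> \bar R}) (t : R) : R :=
  1 / levy_Psi_inv nu (1 / t).

Definition char_fun (mu : probability 'rV[R]_d R) (xi : 'rV[R]_d) : R[i] :=
  (\int[mu]_y cos (dotp xi y)) +i* (\int[mu]_y sin (dotp xi y)).

Definition convolution (mu1 mu2 : probability 'rV[R]_d R) :
    set 'rV[R]_d -> \bar R :=
  pushforward (mu1 \x mu2)%E (fun p => p.1 + p.2).

(* A family indexed by all of R of which only the part 0 <= t is constrained.
   Weak continuity at 0 is implied by the last field. *)
Record levy_semigroup (nu : {measure set 'rV[R]_d -> \bar R})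
    (P : R -> probability 'rV[R]_d R) : Prop := LevySemigroup {
  levy_semigroup0 : forall A, measurable A -> P 0 A = \d_(0 : 'rV[R]_d) A;
  levy_semigroupD : forall s t A, 0 <= s -> 0 <= t -> measurable A ->
    P (s + t) A = convolution (P s) (P t) A;
  levy_semigroup_char : forall t xi, 0 <= t ->
    char_fun (P t) xi = (expR (- t * levy_exponent nu xi))%:C }.

Record continuous_density (mu : probability 'rV[R]_d R) (p : 'rV[R]_d -> R) :
    Prop := ContinuousDensity {
  density_continuous : continuous p;
  density_ge0 : forall x, 0 <= p x;
  densityE : forall A, measurable A ->
    mu A = (\int[lebesgue_rV R d]_(x in A) (p x)%:E)%E }.

End levy.

(* Main.v *)
(* For t > 0 the Gaussian averages of P_t around x equal
   (2 pi)^-d int exp(-t Phi(xi)) cos(xi . x) exp(-e^2 |xi|^2 / 2) dxi.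
   Since t Phi <= 1 on the ball of radius 1 / h(t), while the integral
   assumption controls the cost of replacing cos(xi . x) by 1, letting e tend
   to 0 gives p_t(x) >= c h(t)^-d for |x| <= a h(t).  Convolving m + 1 copies of
   this near-diagonal bound at time t / (m + 1) gives
   p_t(x) >= c kappa^m h(t / (m + 1))^-d for |x| <= (m + 1) a h(t / (m + 1)) / 3.
   From Phi(2 xi) <= 4 Phi(xi) one gets h(s) >= c sqrt(s) for large s, so m of
   order |x|^2 / t is admissible as long as |x| <= c t, and then kappa^m is the
   Gaussian factor. *)
Require Import Defs.
From mathcomp Require Import all_boot all_order all_algebra.
From mathcomp Require Import all_classical all_reals all_analysis.
From mathcomp Require Import measurable_realfun ring lra complex.

Set Implicit Arguments.
Unset Strict Implicit.
Unset Printing Implicit Defensive.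
Import Order.TTheory GRing.Theory Num.Theory.
Import numFieldNormedType.Exports.

Local Open Scope classical_set_scope.
Local Open Scope ring_scope.

(** * The one-dimensional Gaussian *)

(** The lower bound on the Gaussian averages of [P t] is uniform in small [e], and a number below
    all of them is below [p t x] because [p t] is continuous: this is the form in which the limit in
    [e] enters. Chaining is done on masses of boxes. The density serves only to bound the mass
    reached in one step and, at the end, to return from the mass of shrinking boxes to a pointwise
    value. The loss per step is a constant because the near-diagonal bound is scale invariant:
    height [c0 * h ^- d] on a box of radius [a * h] gives a mass independent of [h]. The
    restrictions on [t] and [x] keep the time [t / (m + 1)] of one step above the threshold beyond
    which [h] dominates a square root. Monotonicity of [h] then exchanges [h (t / (m + 1)) ^- d] for
    [h t ^- d]. All facts on [h] are read off the points [r] with [Psi r = 1 / t]: each bounds [Phi]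
    by [1 / t] on the ball of radius [r], and [1 / h t] is their supremum. *)

(** The fundamental theorem of calculus on the intervals from [-n] to [n], with dominated
    convergence by the absolute value of [f]. This is the form of integration by parts used
    below. *)
Lemma Rintegral_derivative_eq0 (R : realType) (F f : R -> R) :
  (forall y : R, is_derive y 1 F (f y)) -> continuous f ->
  (@lebesgue_measure R).-integrable setT (EFin \o f) ->
  F n%:R - F (- n%:R) @[n --> \oo] --> (0 : R) ->
  \int[@lebesgue_measure R]_y f y = 0.
Proof.
move=> dF cf intf F0.
have mf : measurable_fun setT f by exact: continuous_measurable_fun.
pose D (n : nat) : set R := `[- n%:R, n%:R]%classic.
pose g (n : nat) : R -> \bar R := (EFin \o f) \_ (D n).
have mg n : measurable_fun setT (g n).
  apply: (measurable_int (@lebesgue_measure R)).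
  apply/integrable_restrict => //; first exact: measurable_itv.
  apply: integrableS intf => //.
  by apply: measurableI => //; exact: measurable_itv.
have [||||_ _] := @dominated_convergence _ _ _ (@lebesgue_measure R) setT
  measurableT g (EFin \o f) (abse \o (EFin \o f)) mg.
- exact/measurable_EFinP.
- apply: aeW => y _; apply: cvg_near_cst.
  exists (Num.bound `|y|) => // n /= yn.
  rewrite /g patchE ifT// inE /D/= in_itv/= -ler_norml.
  rewrite (le_trans (ltW (archi_boundP (normr_ge0 y))))//.
  by rewrite ler_nat.
- exact: integrable_abse.
- apply: aeW => y n _ /=; rewrite /g patchE; case: ifPn => // _.
  by rewrite abse0.
rewrite /= => cv.
(* The index is shifted because the interval must have nonempty interior. *)
have e n : (\int[@lebesgue_measure R]_y g n.+1 y)%E = (F n.+1%:R - F (- n.+1%:R))%:E.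
  rewrite /g -integral_mkcond.
  have n0 : - n.+1%:R < n.+1%:R :> R by rewrite gtrN.
  have cF : continuous F.
    by move=> y; apply/differentiable_continuous/derivable1_diffP; case: (dF y).
  rewrite (@continuous_FTC2 _ f F)//.
  - exact: continuous_subspaceT.
  - split => //.
    + by apply: cvg_at_right_filter; exact: cF.
    + by apply: cvg_at_left_filter; exact: cF.
  - by move=> x _; rewrite derive1E; case: (dF x).
have {cv} cv : (\int[@lebesgue_measure R]_y g n.+1 y)%E @[n --> \oo] -->
  (\int[@lebesgue_measure R]_y (EFin \o f) y)%E.
  by rewrite (cvg_shiftS (fun n => \int[@lebesgue_measure R]_y g n y)%E).
have {F0} F0 : (F n.+1%:R - F (- n.+1%:R))%:E @[n --> \oo] --> 0%:E.
  apply: cvg_EFin; first exact: nearW.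
  by rewrite (cvg_shiftS (fun n => F n%:R - F (- n%:R))).
rewrite (_ : (fun n => _) = (fun n => (F n.+1%:R - F (- n.+1%:R))%:E)) in cv; last exact/funext.
have : (\int[@lebesgue_measure R]_y (EFin \o f) y)%E = 0%:E.
  exact: (cvg_unique _ cv F0).
by rewrite /Rintegral => ->.
Qed.

Section gauss.
Context {R : realType} (s : R) (s0 : s != 0).
Local Notation leb := (@lebesgue_measure R).
Local Notation N := (normal_pdf 0 s).

Lemma is_derive_normal_pdf (y : R) : is_derive y 1 N (- (y / s ^+ 2) * N y).
Proof.
rewrite normal_pdfE// /normal_fun.
pose k := - (s ^+ 2 *+ 2)^-1.
rewrite (_ : (fun _ => _) = normal_peak s *: (expR \o (k *: (@GRing.exp R ^~ 2%N)))); last first.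
  apply/funext => z /=; rewrite /k subr0 [in RHS]/GRing.scale/= /GRing.scale/=.
  by congr (_ * expR _); ring.
apply: is_derive_eq; rewrite subr0.
rewrite (_ : (k *: (@GRing.exp R ^~ 2%N)) y = - y ^+ 2 / (s ^+ 2 *+ 2)); last first.
  by rewrite /k [LHS]/GRing.scale/= /GRing.scale/=; ring.
rewrite /GRing.scale/= mulr1.
by rewrite /k; field.
Qed.

(** Doubling the standard deviation absorbs the linear factor. The two exponentials differ by
    [expR (3 * y ^+ 2 / (8 * s ^+ 2))], which is at least one plus its exponent; multiplied by
    [1 + 8 / 3 * s ^+ 2] this exceeds [1 + y ^+ 2], hence the absolute value of [y]. Both
    integrability and decay at infinity follow. *)
Lemma normal_pdf_norm_le : exists2 C, 0 <= C &
  forall y, `|y| * N y <= C * normal_pdf 0 (2 * s) y.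
Proof.
have s20 : 2 * s != 0 by rewrite mulf_neq0.
pose C := (1 + 8 / 3 * s ^+ 2) * normal_peak s / normal_peak (2 * s).
have p0 := normal_peak_gt0 s0.
have p20 := normal_peak_gt0 s20.
have ss : 0 < s ^+ 2 by rewrite exprn_even_gt0.
exists C => [|y].
  by rewrite /C !mulr_ge0 ?invr_ge0 ?(ltW p0) ?(ltW p20)//; nra.
rewrite !normal_pdfE//= /normal_fun !subr0.
rewrite /C.
set A := expR _; set B := expR _.
rewrite [leRHS](_ : _ = (normal_peak s) * ((1 + 8 / 3 * s ^+ 2) * B)); last first.
  by field; rewrite gt_eqF.
rewrite mulrCA ler_pM2l//.
have -> : B = A * expR (3 * y ^+ 2 / (8 * s ^+ 2)).
  rewrite /A /B -expRD; by congr expR; field.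
rewrite mulrCA mulrC ler_pM2l ?expR_gt0//.
have h1 : 1 + 3 * y ^+ 2 / (8 * s ^+ 2) <= expR (3 * y ^+ 2 / (8 * s ^+ 2)).
  exact: expR_ge1Dx.
have h2 : `|y| <= 1 + y ^+ 2.
  rewrite -(real_normK (num_real y)); have := normr_ge0 y; nra.
apply: (le_trans h2).
apply: le_trans (ler_wpM2l _ h1); last by nra.
rewrite [leRHS](_ : _ = 1 + 8 / 3 * s ^+ 2 + 3 * y ^+ 2 / (8 * s ^+ 2) + y ^+ 2); last first.
  by field.
have : 0 <= 3 * y ^+ 2 / (8 * s ^+ 2).
  by rewrite divr_ge0// mulr_ge0// sqr_ge0.
lra.
Qed.

Lemma integrable_normM_normal_pdf :
  leb.-integrable setT (EFin \o (fun y => `|y| * N y)).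
Proof.
have [C C0 HC] := normal_pdf_norm_le.
apply: (@le_integrable _ _ _ leb setT measurableT _
  (fun y => C%:E * (normal_pdf 0 (2 * s) y)%:E)%E).
- apply/measurable_EFinP; apply: measurable_funM; first exact: normr_measurable.
  exact: measurable_normal_pdf.
- move=> y _ /=; rewrite lee_fin [leLHS]ger0_norm ?[leRHS]ger0_norm//.
  + by rewrite mulr_ge0 ?normal_pdf_ge0.
  + by rewrite mulr_ge0 ?normal_pdf_ge0.
- exact: (integrableZl measurableT C (integrable_normal_pdf 0 (2 * s))).
Qed.

Lemma integrable_bounded_normal_pdf (g : R -> R) : measurable_fun setT g ->
  (forall y, `|g y| <= 1) -> leb.-integrable setT (EFin \o (fun y => g y * N y)).
Proof.
move=> mg g1.
apply: (@le_integrable _ _ _ leb setT measurableT _ (fun y => (N y)%:E)).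
- apply/measurable_EFinP; apply: measurable_funM => //; exact: measurable_normal_pdf.
- move=> y _ /=; rewrite lee_fin normrM ler_piMl//.
- exact: integrable_normal_pdf.
Qed.

Lemma cvg_normal_pdf0 : N n%:R @[n --> \oo] --> (0 : R).
Proof.
have [C C0 HC] := normal_pdf_norm_le.
have s20 : 2 * s != 0 by rewrite mulf_neq0.
rewrite -(cvg_shiftS (fun n => N n%:R)).
apply: (@squeeze_cvgr _ _ _ _ (cst 0) (fun n => C * normal_peak (2 * s) * n.+1%:R^-1)).
- near=> n; rewrite normal_pdf_ge0//= ler_pdivlMr// mulrC.
  apply: le_trans (ler_wpM2l C0 (normal_pdf_ub 0 _ s20)).
  by rewrite -{1}(@ger0_norm _ n.+1%:R)// HC.
- exact: cvg_cst.
- rewrite -(mulr0 (C * normal_peak (2 * s))); apply: cvgMl_tmp => //.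
  exact: cvg_harmonic.
Unshelve. all: by end_near. Qed.
End gauss.

Section gauss.
Context {R : realType} (s : R) (s0 : s != 0).
Local Notation leb := (@lebesgue_measure R).
Local Notation N := (normal_pdf 0 s).

Lemma is_derive_affine (a b y : R) : is_derive y 1 (fun x : R => a * x + b) a.
Proof.
rewrite (_ : (fun _ => _) = (a *: id) + cst b)//.
by apply: is_derive_eq; rewrite /GRing.scale/= mulr1 addr0.
Qed.

Lemma continuous_affine (a b : R) : continuous (fun x : R => a * x + b).
Proof.
move=> y; apply/differentiable_continuous/derivable1_diffP.
by case: (is_derive_affine a b y).
Qed.

Let phi c a := \int[leb]_y (cos (a * y + c) * N y).

Lemma is_derive_cos_affine (a y c : R) :
  is_derive a 1 (fun x : R => cos (x * y + c)) (- (y * sin (a * y + c))).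
Proof.
have d := is_derive_affine y c a.
rewrite (_ : (fun _ => _) = cos \o (fun x => y * x + c)); last first.
  by apply/funext => z /=; rewrite mulrC.
by apply: is_derive_eq; rewrite (mulrC y a); ring.
Qed.

Lemma is_derive_sin_affine (a y c : R) :
  is_derive y 1 (fun x : R => sin (a * x + c)) (a * cos (a * y + c)).
Proof.
have d := is_derive_affine a c y.
rewrite (_ : (fun _ => _) = sin \o (fun x => a * x + c))//.
by apply: is_derive_eq; rewrite mulrC.
Qed.

Lemma continuous_cos_affine (a c : R) : continuous (fun y : R => cos (a * y + c)).
Proof.
by move=> y; apply: (cvg_comp (fun z => a * z + c) cos);
  [exact: continuous_affine|exact: continuous_cos].
Qed.

Lemma continuous_sin_affine (a c : R) : continuous (fun y : R => sin (a * y + c)).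
Proof.
by move=> y; apply: (cvg_comp (fun z => a * z + c) sin);
  [exact: continuous_affine|exact: continuous_sin].
Qed.

Lemma integrable_cos_normal_pdf a c :
  leb.-integrable setT (EFin \o (fun y => cos (a * y + c) * N y)).
Proof.
apply: integrable_bounded_normal_pdf => [|y]; last exact: cos_max.
by apply: continuous_measurable_fun; exact: continuous_cos_affine.
Qed.

Lemma integrable_Msin_normal_pdf a c :
  leb.-integrable setT (EFin \o (fun y => y * sin (a * y + c) * N y)).
Proof.
apply: (@le_integrable _ _ _ leb setT measurableT _ (EFin \o (fun y => `|y| * N y))).
- apply/measurable_EFinP; apply: measurable_funM; last exact: measurable_normal_pdf.
  apply: measurable_funM => //.
  by apply: continuous_measurable_fun; exact: continuous_sin_affine.
- move=> y _ /=; rewrite lee_fin !normrM normr_id ler_wpM2r// ler_piMr//.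
  exact: sin_max.
- exact: integrable_normM_normal_pdf.
Qed.

(** Integration by parts: the integral of the derivative of [sin (a * y + c) * N y] vanishes. *)
Let parts c a : \int[leb]_y (y * sin (a * y + c) * N y) = s ^+ 2 * a * phi c a.
Proof.
have ss : s ^+ 2 != 0 by rewrite expf_neq0.
have : \int[leb]_y (a * (cos (a * y + c) * N y) - s ^- 2 * (y * sin (a * y + c) * N y)) = 0.
  apply: (@Rintegral_derivative_eq0 _ (fun y => sin (a * y + c) * N y)).
  - move=> y.
    have d1 := is_derive_sin_affine a y c; have d2 := is_derive_normal_pdf s0 y.
    rewrite (_ : (fun _ => _) = (fun x : R => sin (a * x + c)) * N)//.
    by apply: is_derive_eq; rewrite /GRing.scale/=; field.
  - have cN := continuous_normal_pdf (m := 0) s0.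
    move=> y; apply: cvgB; apply: cvgMl_tmp.
      by apply: cvgM; [exact: continuous_cos_affine|exact: cN].
    apply: cvgM; last exact: cN.
    by apply: cvgM; [exact: cvg_id|exact: continuous_sin_affine].
  - have := integrableB measurableT
     (integrableZl measurableT a (integrable_cos_normal_pdf a c))
     (integrableZl measurableT (s ^- 2) (integrable_Msin_normal_pdf a c)).
    by apply: eq_integrable.
  - apply: norm_cvg0.
    apply: (@squeeze_cvgr _ _ _ _ (cst 0) (fun n : nat => 2 * N n%:R)).
    + near=> n; rewrite normr_ge0/=.
      rewrite (_ : N (- n%:R) = N n%:R); last first.
        by rewrite normal_pdfE//= /normal_fun !subr0 sqrrN.
      rewrite -mulrBl normrM (ger0_norm (normal_pdf_ge0 _ _ _)).
      rewrite ler_wpM2r ?normal_pdf_ge0// (le_trans (ler_normB _ _))//.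
      by rewrite (_ : 2 = 1 + 1)// lerD// sin_max.
    + exact: cvg_cst.
    + by rewrite -[X in _ --> X](mulr0 2); apply: cvgMl_tmp; exact: cvg_normal_pdf0.
rewrite RintegralB//; last 2 first.
- exact: (integrableZl measurableT a (integrable_cos_normal_pdf a c)).
- exact: (integrableZl measurableT (s ^- 2) (integrable_Msin_normal_pdf a c)).
rewrite !RintegralZl//; last 2 first.
- exact: integrable_Msin_normal_pdf.
- exact: integrable_cos_normal_pdf.
move/eqP; rewrite subr_eq0 => /eqP /(congr1 (fun x => s ^+ 2 * x)).
by rewrite !mulrA divff// mul1r => <-.
Unshelve. all: by end_near. Qed.

(** Differentiation under the integral, dominated by the first absolute moment density, followed by
    [parts]: [phi c] solves a linear differential equation in [a]. *)
Let is_derive_phi (c a : R) : is_derive a 1 (phi c) (- (s ^+ 2 * a * phi c a)).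
Proof.
pose f (x y : R) := cos (x * y + c) * N y.
have df (x y : R) : is_derive x 1 (f ^~ y) (- (y * sin (x * y + c) * N y)).
  have d1 := is_derive_cos_affine x y c.
  rewrite (_ : f ^~ y = N y *: (fun x => cos (x * y + c))); last first.
    by apply/funext => z; rewrite /f /= [RHS]/GRing.scale/= /GRing.scale/= mulrC.
  by apply: is_derive_eq; rewrite /GRing.scale/=; ring.
have Ia : `]a - 1, a + 1[%classic a by rewrite /= in_itv/= ltrDl ltrBlDr ltrDl ltr01.
have p1 (x y : R) : partial1of2 f x y = - (y * sin (x * y + c) * N y).
  by rewrite /partial1of2 derive1E; case: (df x y).
have G1 (x y : R) : `]a - 1, a + 1[%classic x -> setT y ->
    `|partial1of2 f x y| <= `|y| * N y.
  move=> _ _; rewrite p1 normrN !normrM (ger0_norm (normal_pdf_ge0 _ _ _)).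
  by rewrite ler_wpM2r ?normal_pdf_ge0// ler_piMr// sin_max.
have intf (x : R) : `]a - 1, a + 1[%classic x -> leb.-integrable setT (EFin \o f x).
  by move=> _; exact: integrable_cos_normal_pdf.
have derf (x y : R) : `]a - 1, a + 1[%classic x -> setT y -> derivable (f ^~ y) x 1.
  by move=> _ _; case: (df x y).
have G0 (y : R) : 0 <= `|y| * N y by rewrite mulr_ge0 ?normal_pdf_ge0.
have D := @derivable_under_integral _ _ _ leb f setT measurableT a _ _ Ia intf derf _ G0
  (integrable_normM_normal_pdf s0) G1.
have E := @differentiation_under_integral _ _ _ leb f setT measurableT a _ _ Ia intf derf _ G0
  (integrable_normM_normal_pdf s0) G1.
apply: DeriveDef; first exact: D.
rewrite -derive1E E -parts -mulN1r -RintegralZl//; last exact: integrable_Msin_normal_pdf.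
by apply: eq_Rintegral => y _; rewrite p1 mulN1r.
Qed.

(** [E] is the integrating factor of the equation for [phi c], so the product is constant and equals
    its value [cos c] at 0. *)
Lemma Rintegral_cos_normal_pdf a c :
  \int[leb]_y (cos (a * y + c) * N y) = cos c * expR (- (s * a) ^+ 2 / 2).
Proof.
pose E (x : R) := expR (s ^+ 2 / 2 * x ^+ 2).
have dE (x : R) : is_derive x 1 E (s ^+ 2 * x * E x).
  rewrite (_ : E = expR \o ((s ^+ 2 / 2) *: (@GRing.exp R ^~ 2%N))); last first.
    by apply/funext => z /=; rewrite [in RHS]/GRing.scale/= /GRing.scale/=.
  apply: is_derive_eq.
  rewrite /= (_ : ((s ^+ 2 / 2) *: (@GRing.exp R ^~ 2%N)) x = s ^+ 2 / 2 * x ^+ 2)//.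
  by rewrite /GRing.scale/= mulr1 /E; field.
have : (phi c * E) a = (phi c * E) 0.
  apply: is_derive_0_is_cst => x.
  have d1 := is_derive_phi c x; have d2 := dE x.
  by apply: is_derive_eq; rewrite /GRing.scale/=; ring.
have -> : (phi c * E) 0 = cos c.
  rewrite [LHS]/GRing.mul/= /phi.
  under eq_Rintegral do rewrite mul0r add0r.
  rewrite RintegralZl//; last exact: integrable_normal_pdf.
  rewrite /Rintegral integral_normal_pdf/= mulr1.
  by rewrite /E expr0n/= mulr0 expR0 mulr1.
rewrite (_ : (phi c * E) a = phi c a * E a)// => <-.
rewrite -mulrA -expRD -[LHS]mulr1 -expR0.
by congr (_ * expR _); rewrite exprMn; ring.
Qed.

End gauss.

(** * Gaussians on row vectors *)

Section lebesgue_rV_fubini.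
Context {R : realType} {n : nat}.
Local Notation leb := (@lebesgue_measure R).
Local Notation L := (lebesgue_rV R).

Lemma ge0_integral_lebesgue_rVS (f : 'rV[R]_n.+1 -> \bar R) :
  measurable_fun setT f -> (forall v, (0 <= f v)%E) ->
  (\int[L n.+1]_v f v = \int[leb]_a \int[L n]_v f (cons_rV (a, v)))%E.
Proof.
move=> mf f0.
transitivity (\int[leb \x L n]_p (f \o cons_rV) p)%E.
  rewrite -[RHS](_ : (\int[pushforward (leb \x L n)%E cons_rV]_v f v)%E = _)//.
  by rewrite ge0_integral_pushforward//; exact: measurable_cons_rV.
rewrite fubini_tonelli1//; last by move=> p /=.
by apply: measurableT_comp => //; exact: measurable_cons_rV.
Qed.

Lemma integral_lebesgue_rVS (f : 'rV[R]_n.+1 -> \bar R) :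
  (L n.+1).-integrable setT f ->
  (\int[L n.+1]_v f v = \int[leb]_a \int[L n]_v f (cons_rV (a, v)))%E.
Proof.
move=> /integrableP[mf foo].
have mfc : measurable_fun setT (f \o cons_rV).
  by apply: measurableT_comp => //; exact: measurable_cons_rV.
have intf : (leb \x L n)%E.-integrable setT (f \o cons_rV).
  apply/integrable12ltyP => //.
  rewrite -(ge0_integral_lebesgue_rVS (f := fun v => `|f v|%E))//.
  exact: measurableT_comp.
transitivity (\int[leb \x L n]_p (f \o cons_rV) p)%E.
  rewrite -[RHS](_ : (\int[pushforward (leb \x L n)%E cons_rV]_v f v)%E = _)//.
  by rewrite integral_pushforward//; exact: measurable_cons_rV.
by rewrite -integral12_prod_meas1.
Qed.

End lebesgue_rV_fubini.

Section dotp.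
Context {R : realType}.

Lemma cons_rV0 n (a : R) (v : 'rV[R]_n) : cons_rV (a, v) 0 0 = a.
Proof. by have /(congr1 fst) := cons_rVK (a, v). Qed.

Lemma cons_rV_lift n (a : R) (v : 'rV[R]_n) i : cons_rV (a, v) 0 (lift ord0 i) = v 0 i.
Proof.
have /(congr1 snd) := cons_rVK (a, v); rewrite [LHS]/= [RHS]/= => e; rewrite -[in RHS]e.
by move: (cons_rV _) => w; rewrite mxE; congr (w _ _); exact/val_inj.
Qed.

Lemma dotpC n (x y : 'rV[R]_n) : dotp x y = dotp y x.
Proof. by apply: eq_bigr => i _; rewrite mulrC. Qed.

Lemma dotp_consl n (x : 'rV[R]_n.+1) (p : R * 'rV[R]_n) :
  dotp (cons_rV p) x = p.1 * x 0 0 + dotp p.2 (\row_i x 0 (lift ord0 i)).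
Proof.
case: p => a v; rewrite /dotp big_ord_recl cons_rV0; congr (_ + _).
by apply: eq_bigr => i _; rewrite cons_rV_lift mxE.
Qed.

Lemma measurable_dotp n d (T : measurableType d) (f g : T -> 'rV[R]_n) :
  measurable_fun setT f -> measurable_fun setT g ->
  measurable_fun setT (fun t => dotp (f t) (g t)).
Proof.
move=> mf mg; apply: measurable_sum => i; apply: measurable_funM.
  by apply: (measurableT_comp (f := fun v : 'rV[R]_n => v 0 i)) => //; exact: measurable_coord.
by apply: (measurableT_comp (f := fun v : 'rV[R]_n => v 0 i)) => //; exact: measurable_coord.
Qed.

Lemma measurable_cos_comp d (T : measurableType d) (f : T -> R) :
  measurable_fun setT f -> measurable_fun setT (fun t => cos (f t)).
Proof.
move=> mf; apply: (measurableT_comp (f := @cos R)) => //.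
by apply: continuous_measurable_fun; exact: continuous_cos.
Qed.

End dotp.

Section gaussian_rV.
Context {R : realType} (s : R) (s0 : s != 0).
Local Notation L := (lebesgue_rV R).

Definition gaussian_rV n (m v : 'rV[R]_n) : R :=
  \prod_(i < n) normal_pdf (m 0 i) s (v 0 i).

Lemma gaussian_rV_ge0 n (m v : 'rV[R]_n) : 0 <= gaussian_rV m v.
Proof. by apply: prodr_ge0 => i _; exact: normal_pdf_ge0. Qed.

Lemma measurable_gaussian_rV n (m : 'rV[R]_n) : measurable_fun setT (gaussian_rV m).
Proof.
apply: measurable_prod => i _.
apply: (measurableT_comp (f := normal_pdf (m 0 i) s)); last exact: measurable_coord.
exact: measurable_normal_pdf.
Qed.

Lemma gaussian_rV_cons n (m : 'rV[R]_n.+1) (a : R) (v : 'rV[R]_n) :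
  gaussian_rV m (cons_rV (a, v)) =
  normal_pdf (m 0 0) s a * gaussian_rV (\row_i m 0 (lift ord0 i)) v.
Proof.
rewrite /gaussian_rV big_ord_recl cons_rV0; congr (_ * _).
by apply: eq_bigr => i _; rewrite cons_rV_lift mxE.
Qed.

Lemma integral_gaussian_rV n (m : 'rV[R]_n) :
  (\int[L n]_v (gaussian_rV m v)%:E = 1)%E.
Proof.
elim: n m => [|n IHn] m.
  rewrite /= integral_dirac//; first by rewrite diracE in_setT mul1e /gaussian_rV big_ord0.
  apply/measurable_EFinP; exact: measurable_gaussian_rV.
rewrite ge0_integral_lebesgue_rVS//; last 2 first.
- apply/measurable_EFinP; exact: measurable_gaussian_rV.
- by move=> v; rewrite lee_fin gaussian_rV_ge0.
rewrite -(integral_normal_pdf (m 0 0) s).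
apply: eq_integral => a _.
under eq_integral do rewrite gaussian_rV_cons EFinM.
rewrite ge0_integralZl//.
- by rewrite IHn mule1.
- apply/measurable_EFinP; exact: measurable_gaussian_rV.
- by move=> v _; rewrite lee_fin gaussian_rV_ge0.
- by rewrite lee_fin normal_pdf_ge0.
Qed.

Lemma integrable_gaussian_rV n (m : 'rV[R]_n) : (L n).-integrable setT (EFin \o gaussian_rV m).
Proof.
apply/integrableP; split.
  apply/measurable_EFinP; exact: measurable_gaussian_rV.
under eq_integral do rewrite /= ger0_norm ?gaussian_rV_ge0//.
by rewrite integral_gaussian_rV ltry.
Qed.

Lemma integrable_cos_gaussian_rV n (y : 'rV[R]_n) c :
  (L n).-integrable setT (EFin \o (fun v => cos (dotp v y + c) * gaussian_rV 0 v)).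
Proof.
apply: (@le_integrable _ _ _ (L n) setT measurableT _ (EFin \o gaussian_rV 0)).
- apply/measurable_EFinP; apply: measurable_funM; last exact: measurable_gaussian_rV.
  by apply: measurable_cos_comp; apply: measurable_funD => //; exact: measurable_dotp.
- by move=> v _ /=; rewrite lee_fin normrM ler_piMl// cos_max.
- exact: integrable_gaussian_rV.
Qed.

(* The phase [c] is what makes the induction on the dimension go through. *)
Lemma integral_cos_gaussian_rV n (y : 'rV[R]_n) c :
  (\int[L n]_v (cos (dotp v y + c) * gaussian_rV 0 v)%:E =
   (cos c * expR (- s ^+ 2 * dotp y y / 2))%:E)%E.
Proof.
elim: n y c => [|n IHn] y c.
  rewrite /= integral_dirac//.
    rewrite diracE in_setT mul1e /gaussian_rV /dotp !big_ord0 add0r.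
    by rewrite mulr0 mul0r expR0.
  by have /integrableP[] := integrable_cos_gaussian_rV y c.
rewrite integral_lebesgue_rVS; last exact: integrable_cos_gaussian_rV.
pose y' : 'rV[R]_n := \row_i y 0 (lift ord0 i).
pose e := expR (- s ^+ 2 * dotp y' y' / 2).
transitivity (\int[@lebesgue_measure R]_a (e * (cos (y 0 0 * a + c) * normal_pdf 0 s a))%:E)%E.
  apply: eq_integral => a _.
  transitivity (\int[L n]_v ((normal_pdf 0 s a)%:E *
     (cos (dotp v y' + (y 0 0 * a + c)) * gaussian_rV 0 v)%:E))%E.
    apply: eq_integral => v _; rewrite gaussian_rV_cons dotp_consl /= -/y'.
    rewrite (_ : (\row_i (0 : 'rV[R]_n.+1) 0 (lift ord0 i)) = 0); last first.
      by apply/rowP => i; rewrite !mxE.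
    rewrite [(0 : 'rV[R]_n.+1) 0 0]mxE -EFinM.
    congr EFin; rewrite mulrCA; congr (_ * (cos _ * _)); ring.
  rewrite integralZl//; last exact: integrable_cos_gaussian_rV.
  by rewrite IHn -EFinM; congr EFin; rewrite /e; ring.
under eq_integral do rewrite EFinM.
rewrite integralZl//; last exact: (integrable_cos_normal_pdf s (y 0 0) c).
have /fineK <- := integrable_fin_num measurableT (integrable_cos_normal_pdf s (y 0 0) c).
rewrite [fine _](Rintegral_cos_normal_pdf s0 (y 0 0) c) -EFinM; congr EFin.
rewrite mulrCA /e -expRD; congr (_ * expR _).
rewrite /dotp [in RHS]big_ord_recl.
under eq_bigr do rewrite !mxE.
by field.
Qed.

End gaussian_rV.

(** * Boxes and Gaussian approximation of densities *)

Lemma continuous_measurable_mx (R : realType) m n (f : 'M[R]_(m, n) -> R) :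
  continuous f -> measurable_fun setT f.
Proof.
move=> cf; apply: (measurability _ (RGenOpens.measurableE R)) => _ [_ [a [b ->] <-]].
rewrite setTI; apply: open_measurable_mx.
by apply: open_comp => [M _|]; [exact: cf|exact: interval_open].
Qed.

Section box.
Context {R : realType} {n : nat}.
Local Notation L := (lebesgue_rV R n).

(** Closed balls of the sup norm: their Lebesgue measure is explicit, and they are preserved by
    translation. *)
Definition box (z : 'rV[R]_n) (r : R) : set 'rV[R]_n :=
  [set v | forall i, `|v 0 i - z 0 i| <= r].

Lemma measurable_box z r : measurable (box z r).
Proof.
rewrite (_ : box z r = \bigcap_(i in [set: 'I_n])
    (fun v : 'rV[R]_n => v 0 i) @^-1` `[z 0 i - r, z 0 i + r]%classic); last first.
  by apply/seteqP; split=> v vP i => [_|]; have := vP i;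
    rewrite /= in_itv/= ler_distl//; apply.
apply: fin_bigcap_measurable => // i _.
by rewrite -[X in measurable X]setTI; exact: measurable_coord.
Qed.

Lemma lebesgue_rV_boxE z r : 0 <= r -> L (box z r) = ((2 * r) ^+ n)%:E.
Proof.
move=> r0; pose c : 'rV[R]_n := const_mx r.
have ab i : (z - c) 0 i <= (z + c) 0 i.
  by rewrite !mxE; lra.
have := lebesgue_rV_box ab.
have e i : (z + c) 0 i - (z - c) 0 i = 2 * r by rewrite !mxE; ring.
rewrite (eq_bigr _ (fun i _ => e i)) prodr_const card_ord => <-; congr (L _).
apply/seteqP; split=> v vP i; have := vP i; by rewrite /= !mxE in_itv/= ler_distl.
Qed.

Lemma nbhs_box (z : 'rV[R]_n) (A : set 'rV[R]_n) : nbhs z A ->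
  exists2 r, 0 < r & box z r `<=` A.
Proof.
move=> /nbhs_ballP[e /= e0 eA]; exists (e / 2); first by rewrite divr_gt0.
move=> v vz; apply: eA; split => // i j; rewrite /ball/= ord1 distrC.
by rewrite (le_lt_trans (vz j))// ltr_pdivrMr//; lra.
Qed.

End box.

(** As set functions, [m] is at most [C] times [l] plus the restriction of [m] to the complement of
    [B]. With a Gaussian centred in [B] for [f], the second part is the tail. *)
Lemma ge0_integral_le_local d (T : measurableType d) (R : realType)
    (m l : {measure set T -> \bar R}) (B : set T) (C : {nonneg R}) (M : R) (f : T -> R) :
  measurable B -> measurable_fun setT f -> (forall x, 0 <= f x) -> 0 <= M ->
  (m setT <= 1)%E ->
  (forall S, measurable S -> S `<=` B -> m S <= C%:num%:E * l S)%E ->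
  (forall x, ~ B x -> f x <= M) ->
  (\int[m]_x (f x)%:E <= C%:num%:E * \int[l]_x (f x)%:E + M%:E)%E.
Proof.
move=> mB mf f0 M0 m1 mS fM.
have mBC : measurable (~` B) by exact: measurableC.
have mEf : measurable_fun setT (EFin \o f) by exact/measurable_EFinP.
have Ef0 x : setT x -> (0 <= (f x)%:E)%E by rewrite lee_fin.
apply: (@le_trans _ _
    (\int[measure_add (mscale C l) (mrestr m mBC)]_x (f x)%:E)%E).
  apply: ge0_le_measure_integral => // S mS'.
  rewrite -[leRHS]/(measure_add (mscale C l) (mrestr m mBC) S) measure_addE.
  rewrite /mscale /mrestr/=.
  rewrite -{1}(setUIDK S B) measureU//; last 3 first.
  - exact: measurableI.
  - exact: measurableD.
  - by rewrite setDE setIACA setICr setI0.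
  rewrite leeD//.
  apply: (le_trans (mS _ _ _)) => //; first exact: measurableI.
  apply: lee_wpmul2l; first by rewrite lee_fin.
  by apply: le_measure; rewrite ?inE//; exact: measurableI.
rewrite ge0_integral_measure_add// ge0_integral_mscale//.
apply: leeD => //.
apply: (@le_trans _ _ (\int[mrestr m mBC]_x (cst M%:E) x)%E).
  apply: ae_ge0_le_integral => //.
  exists B; split => //.
    by rewrite -[LHS]/(m (B `&` ~` B)) setICr measure0.
  by move=> x /= H; apply: contrapT => Bx; apply: H => _; rewrite lee_fin fM.
rewrite integral_cst// -[X in (_ * X)%E]/(m (setT `&` ~` B)) setTI.
rewrite -[leRHS]mule1; apply: lee_wpmul2l; first by rewrite lee_fin.
by apply: (le_trans _ m1); apply: le_measure; rewrite ?inE.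
Qed.

Section gaussian.
Context {R : realType}.

Lemma gaussian_rVE (s : R) n (m v : 'rV[R]_n) : s != 0 ->
  gaussian_rV s m v = normal_peak s ^+ n * expR (- dotp (v - m) (v - m) / (s ^+ 2 *+ 2)).
Proof.
move=> s0; rewrite /gaussian_rV.
under eq_bigr do rewrite normal_pdfE//.
rewrite big_split/= prodr_const card_ord; congr (_ * _).
rewrite -expR_sum; congr expR; rewrite /dotp -sumrN mulr_suml.
by apply: eq_bigr => i _; rewrite !mxE expr2.
Qed.

Lemma normal_peak_le (s : R) : 0 < s -> normal_peak s <= s^-1.
Proof.
move=> s0; rewrite /normal_peak lef_pV2 ?posrE ?sqrtr_gt0//; last first.
  by rewrite pmulrn_lgt0// mulr_gt0 ?pi_gt0 ?exprn_gt0.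
rewrite -[leLHS](gtr0_norm s0) -sqrtr_sqr ler_wsqrtr//.
have := @pi_ge2 R; have : 0 < s ^+ 2 by rewrite exprn_gt0.
by nra.
Qed.

(** Off the box the exponential is at most [expR (- u)] with [u] of order [e ^- 2]. Since [expR u]
    is the [n.+1]-st power of [expR (u / n.+1%:R)], this is at most [(u / n.+1%:R) ^- n.+1], that is
    [K * e ^+ (2 * n.+1)]. It beats the normalisation [e ^- n] and leaves [K * e ^+ n.+2], at most
    [K * e] for [e] below 1. *)
Lemma gaussian_rV_tail n (r eta : R) : 0 < r -> 0 < eta ->
  exists2 e0, 0 < e0 & forall e (x y : 'rV[R]_n), 0 < e < e0 -> ~ box x r y ->
    gaussian_rV e x y <= eta.
Proof.
move=> r0 eta0.
pose K := (2 * n.+1%:R / r ^+ 2) ^+ n.+1.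
have K0 : 0 < K by rewrite exprn_gt0// divr_gt0 ?exprn_gt0// mulr_gt0.
exists (Num.min 1 (eta / K)).
  by rewrite lt_min ltr01 divr_gt0.
move=> e x y /andP[e0]; rewrite lt_min => /andP[e1 eeta] /existsNP[i /negP].
rewrite -ltNge => rxy.
rewrite gaussian_rVE ?gt_eqF//.
have rd : r ^+ 2 <= dotp (y - x) (y - x).
  rewrite /dotp (bigD1 i)//= -[leLHS]addr0 lerD//.
    rewrite !mxE -expr2 -(real_normK (num_real (_ - _))).
    by rewrite lerXn2r ?nnegrE ?(ltW r0) ?(ltW rxy).
  by apply: sumr_ge0 => j _; rewrite -expr2 sqr_ge0.
pose u := r ^+ 2 / (2 * e ^+ 2).
have u0 : 0 < u by rewrite divr_gt0 ?exprn_gt0// mulr_gt0 ?exprn_gt0.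
have hu : (u / n.+1%:R) ^+ n.+1 <= expR u.
  rewrite -[u in expR u](@divfK _ n.+1%:R)// expRM_natr.
  have un0 : 0 <= u / n.+1%:R by rewrite divr_ge0// ltW.
  rewrite lerXn2r ?nnegrE ?expR_ge0//.
  by apply: le_trans (expR_ge1Dx _); rewrite lerDr.
have h1 : normal_peak e ^+ n <= e ^- n.
  by rewrite -exprVn lerXn2r ?nnegrE ?invr_ge0 ?sqrtr_ge0 ?(ltW e0)// normal_peak_le.
have h2 : expR (- dotp (y - x) (y - x) / (e ^+ 2 *+ 2)) <= (u / n.+1%:R) ^- n.+1.
  apply: (@le_trans _ _ (expR (- u))).
    rewrite ler_expR mulNr lerN2 /u (_ : e ^+ 2 *+ 2 = 2 * e ^+ 2); last by rewrite mulr_natl.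
    rewrite ler_wpM2r// invr_ge0.
    by rewrite mulr_ge0 ?exprn_ge0 ?(ltW e0).
  by rewrite expRN lef_pV2 ?posrE ?expR_gt0// exprn_gt0// divr_gt0.
apply: (le_trans (ler_pM _ _ h1 h2)); rewrite ?expR_ge0 ?exprn_ge0 ?normal_peak_ge0//.
have eu : (u / n.+1%:R) ^- n.+1 = K * e ^+ (n + n.+2).
  rewrite (_ : (n + n.+2 = 2 * n.+1)%N); last by rewrite mul2n doubleS -addnn !addnS.
  rewrite /K exprM -exprMn -exprVn; congr (_ ^+ _); rewrite /u.
  by field; rewrite !gt_eqF// addrC natr1.
rewrite eu exprD mulrCA mulKf ?expf_neq0 ?gt_eqF//.
rewrite mulrC -ler_pdivlMr//.
apply: le_trans (ltW eeta); rewrite exprS ler_piMr ?(ltW e0)//.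
by rewrite exprn_ile1// ltW.
Qed.

(** If [p x < b], continuity keeps [p] below [p x + eta] on a box around [x], and the tail outside
    contributes at most [eta]. So the average is at most [p x + 2 * eta], while [b] is
    [p x + 3 * eta]. *)
Lemma density_ge_gaussian n (mu : probability 'rV[R]_n R) (p : 'rV[R]_n -> R)
    (x : 'rV[R]_n) (b e0 : R) :
  continuous_density mu p -> 0 < e0 ->
  (forall e, 0 < e < e0 -> (b%:E <= \int[mu]_y (gaussian_rV e x y)%:E)%E) ->
  b <= p x.
Proof.
move=> [cp p0 muE] e00 He; rewrite leNgt; apply/negP => pb.
pose eta := (b - p x) / 3.
have eta0 : 0 < eta by rewrite divr_gt0// subr_gt0.
have [r r0 rp] : exists2 r : R, 0 < r & box x r `<=` [set y | p y < p x + eta].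
  apply: nbhs_box; apply: (cvgr_lt _ (cp x)); rewrite ltrDl//.
have [e1 e10 tail] := gaussian_rV_tail n r0 eta0.
pose e := Num.min e0 e1 / 2.
have m0 : 0 < Num.min e0 e1 by rewrite lt_min e00.
have me0 : Num.min e0 e1 <= e0 by rewrite ge_min lexx.
have me1 : Num.min e0 e1 <= e1 by rewrite ge_min lexx orbT.
have ee0 : 0 < e < e0 by rewrite /e; apply/andP; split; lra.
have ee1 : 0 < e < e1 by rewrite /e; apply/andP; split; lra.
have C0 : 0 <= p x + eta by rewrite addr_ge0// ltW.
have mu1 : (mu setT <= 1)%E by rewrite probability_setT.
have := @ge0_integral_le_local _ _ _ mu (lebesgue_rV R n) (box x r) (NngNum C0)
  eta (gaussian_rV e x) (measurable_box x r) (measurable_gaussian_rV e x)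
  (gaussian_rV_ge0 e x) (ltW eta0) mu1.
rewrite integral_gaussian_rV mule1 -EFinD.
have H : forall S, measurable S -> S `<=` box x r ->
    (mu S <= (NngNum C0)%:num%:E * lebesgue_rV R n S)%E.
  move=> S mS SB; rewrite muE//= -integral_cst//.
  apply: ge0_le_integral => //.
  - by move=> y _; rewrite lee_fin.
  - by apply/measurable_EFinP/measurable_funTS; exact: continuous_measurable_mx.
  - by move=> y Sy; rewrite lee_fin ltW//; exact/rp/SB.
move=> /(_ H (fun y => tail e x y ee1)).
have := He _ ee0 => /le_trans h /h; rewrite lee_fin /= /eta; lra.
Qed.
End gaussian.

(** * Fourier inversion with Gaussian smoothing *)

Section trigonometric_bounds.
Context {R : realType}.
Implicit Types u v : R.

Lemma sin_norm_le v : `|sin v| <= `|v|.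
Proof.
wlog v0 : v / 0 <= v => [H|].
  have [|v0] := leP 0 v; first exact: H.
  by rewrite -normrN -sinN -[leRHS]normrN H// oppr_ge0 ltW.
have cs : {within `[0, v], continuous (@sin R)}.
  by apply: continuous_subspaceT => x; exact: continuous_sin.
have [c _] := MVT_segment v0 (fun x _ => is_derive_sin x) cs.
rewrite sin0 !subr0 => ->; rewrite normrM ler_piMl//; exact: cos_max.
Qed.

Lemma onem_cosE u : 1 - cos u = 2 * sin (u / 2) ^+ 2.
Proof.
have e : u = (u / 2) *+ 2 by rewrite -mulr_natr divfK.
rewrite {1}e cos_mulr2n sin2cos2 -mulr_natr; ring.
Qed.

Lemma onem_cos_ge0 u : 0 <= 1 - cos u.
Proof. by rewrite onem_cosE mulr_ge0// sqr_ge0. Qed.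

Lemma onem_cos_le2 u : 1 - cos u <= 2.
Proof.
by rewrite onem_cosE ler_piMr// -(real_normK (num_real (sin _))) exprn_ile1// sin_max.
Qed.

Lemma onem_cos_le_sqr u : 1 - cos u <= u ^+ 2 / 2.
Proof.
rewrite onem_cosE.
have : sin (u / 2) ^+ 2 <= (u / 2) ^+ 2.
  rewrite -(real_normK (num_real (sin _))) -[leRHS](real_normK (num_real _)).
  by rewrite lerXn2r ?nnegrE// sin_norm_le.
rewrite exprMn; lra.
Qed.

Lemma cos_ge_norm u : 1 - `|u| <= cos u.
Proof.
rewrite lerBlDr addrC -lerBlDr.
have [u2|/ltW u2] := leP 2 `|u|.
  by rewrite (le_trans (onem_cos_le2 u)).
apply: (le_trans (onem_cos_le_sqr u)).
rewrite -(real_normK (num_real u)); have := normr_ge0 u; nra.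
Qed.

(** The difference of the two sides is [2 * (1 - cos u) ^+ 2]. Integrated against [nu], this is the
    doubling bound for [Phi]. *)
Lemma onem_cosM2_le u : 1 - cos (2 * u) <= 4 * (1 - cos u).
Proof.
have := onem_cos_ge0 u; rewrite [2 * u]mulrC mulr_natr cos_mulr2n -mulr_natr.
have := sqr_ge0 (1 - cos u); nra.
Qed.

End trigonometric_bounds.

Section euclidean_norm.
Context {R : realType} {n : nat}.
Implicit Types x y : 'rV[R]_n.

Lemma dotp_ge0 x : 0 <= dotp x x.
Proof. by apply: sumr_ge0 => i _; rewrite -expr2 sqr_ge0. Qed.

Lemma enorm_ge0 x : 0 <= enorm x. Proof. exact: sqrtr_ge0. Qed.

Lemma enorm_sqr x : enorm x ^+ 2 = dotp x x.
Proof. by rewrite sqr_sqrtr// dotp_ge0. Qed.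

Lemma coord_le_enorm x i : `|x 0 i| <= enorm x.
Proof.
rewrite -sqrtr_sqr ler_wsqrtr// /dotp (bigD1 i)//= expr2 lerDl.
by apply: sumr_ge0 => j _; rewrite -expr2 sqr_ge0.
Qed.

Lemma enorm_le_coord x r : 0 <= r -> (forall i, `|x 0 i| <= r) -> enorm x <= n%:R * r.
Proof.
move=> r0 xr; rewrite -(ler_pXn2r (n := 2))// ?nnegrE ?enorm_ge0 ?mulr_ge0//.
rewrite enorm_sqr /dotp (@le_trans _ _ (\sum_(i < n) r ^+ 2))//.
  apply: ler_sum => i _; rewrite -expr2 -(real_normK (num_real _)).
  by rewrite lerXn2r ?nnegrE.
rewrite sumr_const card_ord exprMn -[leLHS]mulr_natl ler_wpM2r ?sqr_ge0//.
by rewrite -natrX ler_nat; case: (n) => // m; rewrite leq_pmulr.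
Qed.

Lemma dotp_norm_le x y r : (forall i, `|y 0 i| <= r) -> `|dotp x y| <= n%:R * r * enorm x.
Proof.
move=> yr; rewrite /dotp (le_trans (ler_norm_sum _ _ _))//.
rewrite (@le_trans _ _ (\sum_(i < n) r * enorm x))//.
  by apply: ler_sum => i _; rewrite normrM mulrC ler_pM// coord_le_enorm.
by rewrite sumr_const card_ord -[leLHS]mulr_natl mulrA.
Qed.

Lemma measurable_enorm : measurable_fun setT (@enorm R n).
Proof.
apply: (measurableT_comp (f := @Num.sqrt R)); last exact: measurable_dotp.
by apply: continuous_measurable_fun; exact: sqrt_continuous.
Qed.

End euclidean_norm.

Section smoothing.
Context {R : realType} {n : nat} (mu : probability 'rV[R]_n R) (q : 'rV[R]_n -> R).
Hypothesis cos_mu : forall xi, \int[mu]_y cos (dotp xi y) = q xi.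
Hypothesis sin_mu : forall xi, \int[mu]_y sin (dotp xi y) = 0.
Local Notation L := (lebesgue_rV R n).

Lemma integrable_cos_prob (xi : 'rV[R]_n) c :
  mu.-integrable setT (EFin \o (fun y => cos (dotp xi y + c))).
Proof.
apply: (@le_integrable _ _ _ mu setT measurableT _ (EFin \o cst 1)).
- apply/measurable_EFinP; apply: measurable_cos_comp; apply: measurable_funD => //.
  exact: measurable_dotp.
- by move=> y _; rewrite lee_fin normr1 cos_max.
- exact: finite_measure_integrable_cst.
Qed.

Lemma Rintegral_cos_prob (xi : 'rV[R]_n) c :
  \int[mu]_y cos (dotp xi y + c) = cos c * q xi.
Proof.
under eq_Rintegral do rewrite cosD mulrC (mulrC (sin _)).
have ic : mu.-integrable setT (EFin \o (fun y => cos (dotp xi y))).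
  have := integrable_cos_prob xi 0.
  by apply: eq_integrable => // y _ /=; rewrite addr0.
have isn : mu.-integrable setT (EFin \o (fun y => sin (dotp xi y))).
  have := integrable_cos_prob xi (- (pi / 2)).
  by apply: eq_integrable => // y _ /=; rewrite cosB cos_pihalf sin_pihalf mulr0 mulr1 add0r.
rewrite RintegralB//; last 2 first.
- exact: (integrableZl measurableT (cos c) ic).
- exact: (integrableZl measurableT (sin c) isn).
by rewrite !RintegralZl// cos_mu sin_mu mulr0 subr0.
Qed.

(** Tonelli gives measurability in [xi] for nonnegative integrands, hence the shift from [cos] to
    [1 + cos] and the subtraction of 1, the total mass. *)
Lemma measurable_char : measurable_fun setT q.
Proof.
rewrite (_ : q = fine \o (fun xi => \int[mu]_y (1 + cos (dotp xi y))%:E)%E \- cst 1); last first.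
  apply/funext => xi /=.
  rewrite -[fine _]/(\int[mu]_y (1 + cos (dotp xi y))).
  rewrite RintegralD//; last 2 first.
  - exact: finite_measure_integrable_cst.
  - have := integrable_cos_prob xi 0.
    by apply: eq_integrable => // y _ /=; rewrite addr0.
  have muT : fine (mu setT) = 1 by rewrite probability_setT.
  rewrite cos_mu Rintegral_cst// [fine _](_ : _ = 1); last exact: muT.
  by ring.
apply: measurable_funB => //; apply: measurableT_comp => //.
apply: (@measurable_fun_fubini_tonelli_F _ _ _ _ _ mu
  (fun p : 'rV[R]_n * 'rV[R]_n => (1 + cos (dotp p.1 p.2))%:E)).
  apply/measurable_EFinP; apply: measurable_funD => //.
  by apply: measurable_cos_comp; exact: measurable_dotp.
move=> p; rewrite lee_fin -lerBlDl sub0r.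
by have := cos_max (dotp p.1 p.2); rewrite ler_norml => /andP[].
Qed.

(** Up to the factor [normal_peak e ^+ n], the Gaussian of deviation [e] at [y - x] is the cosine
    transform of the Gaussian of deviation [e^-1]. Fubini applies since the latter is integrable and
    [mu] is finite; the inner integral over [mu] is then the characteristic function with phase
    [- dotp xi x]. *)
Lemma gaussian_smoothing (e : R) (x : 'rV[R]_n) : 0 < e ->
  (\int[mu]_y (gaussian_rV e x y)%:E =
   \int[L]_xi ((normal_peak e ^+ n)%:E *
     (q xi * cos (dotp xi x) * gaussian_rV e^-1 0 xi)%:E))%E.
Proof.
move=> e0; have s0 : e^-1 != 0 by rewrite gt_eqF// invr_gt0.
pose K := normal_peak e ^+ n.
have K0 : 0 <= K by rewrite exprn_ge0// normal_peak_ge0.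
pose f (p : 'rV[R]_n * 'rV[R]_n) : \bar R :=
  (K%:E * (cos (dotp p.2 p.1 + - dotp p.2 x) * gaussian_rV e^-1 0 p.2)%:E)%E.
have mf : measurable_fun setT f.
  apply: measurable_funeM; apply/measurable_EFinP; apply: measurable_funM.
    apply: measurable_cos_comp; apply: measurable_funD; first exact: measurable_dotp.
    by apply: measurableT_comp => //; exact: measurable_dotp.
  apply: (measurableT_comp (f := gaussian_rV e^-1 0)) => //.
  exact: measurable_gaussian_rV.
have intf : (mu \x L)%E.-integrable setT f.
  apply/integrable12ltyP => //.
  apply: (@le_lt_trans _ _ (\int[mu]_y (cst K%:E) y)%E); last first.
    have muT : (mu setT = 1)%E by rewrite probability_setT.
    by rewrite integral_cst// [X in (_ * X)%E](_ : _ = 1%E)// mule1 ltry.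
  apply: ge0_le_integral => //.
  - by move=> y _; apply: integral_ge0.
  - apply: (@measurable_fun_fubini_tonelli_F _ _ _ _ _ L (fun p => `|f p|%E)) => //.
    exact: measurableT_comp.
  move=> y _ /=.
  apply: (@le_trans _ _ (\int[L]_xi (K%:E * (gaussian_rV e^-1 0 xi)%:E))%E); last first.
    rewrite ge0_integralZl//; first by rewrite integral_gaussian_rV mule1.
    - by apply/measurable_EFinP; exact: measurable_gaussian_rV.
    - by move=> xi _; rewrite lee_fin gaussian_rV_ge0.
  apply: ge0_le_integral => //.
  - have mfy : measurable_fun setT (fun xi => `|f (y, xi)|%E).
      by apply: measurableT_comp => //; exact: measurable_fun_pair2.
    exact: mfy.
  - by apply: measurable_funeM; apply/measurable_EFinP; exact: measurable_gaussian_rV.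
  move=> xi _; rewrite /f /= -EFinM lee_fin normrM (ger0_norm K0) ler_wpM2l// normrM.
  by rewrite (ger0_norm (gaussian_rV_ge0 _ _ _)) ler_piMl ?gaussian_rV_ge0// cos_max.
transitivity (\int[mu]_y \int[L]_xi f (y, xi))%E.
  apply: eq_integral => y _.
  transitivity (\int[L]_xi (K%:E * (cos (dotp xi (y - x) + 0) * gaussian_rV e^-1 0 xi)%:E))%E.
    rewrite integralZl//; last exact: integrable_cos_gaussian_rV.
    rewrite integral_cos_gaussian_rV// -EFinM; congr EFin.
    rewrite gaussian_rVE ?gt_eqF// -/K cos0 mul1r; congr (_ * expR _).
    by field; rewrite gt_eqF.
  apply: eq_integral => xi _; rewrite /f /= addr0; congr (_ * (cos _ * _)%:E)%E.
  rewrite /dotp -sumrN -big_split/=; apply: eq_bigr => i _.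
  by rewrite !mxE; ring.
rewrite (Fubini intf); apply: eq_integral => xi _; rewrite /f /=.
pose g := K * gaussian_rV e^-1 0 xi.
transitivity (\int[mu]_y (g%:E * (cos (dotp xi y + - dotp xi x))%:E))%E.
  by apply: eq_integral => y _; rewrite -!EFinM; congr EFin; rewrite /g; ring.
rewrite integralZl//; last exact: integrable_cos_prob.
have /fineK <- := integrable_fin_num measurableT (integrable_cos_prob xi (- dotp xi x)).
rewrite [fine _](Rintegral_cos_prob xi (- dotp xi x)) -!EFinM; congr EFin.
by rewrite cosN /g -/K; ring.
Qed.

End smoothing.

(** The two normalisations combine to the constant of Fourier inversion, free of [e]. *)
Lemma normal_peakM_inv (R : realType) (e : R) : 0 < e ->
  normal_peak e * normal_peak e^-1 = (pi *+ 2)^-1.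
Proof.
move=> e0; rewrite /normal_peak -invfM -sqrtrM; last first.
  by rewrite mulrn_wge0// mulr_ge0 ?pi_ge0 ?sqr_ge0.
rewrite (_ : e ^+ 2 * pi *+ 2 * (e^-1 ^+ 2 * pi *+ 2) = (pi *+ 2) ^+ 2).
  by rewrite sqrtr_sqr ger0_norm// mulrn_wge0// pi_ge0.
by field; rewrite gt_eqF.
Qed.

Section near_diagonal.
Context {R : realType} {n : nat} (mu : probability 'rV[R]_n R) (q : 'rV[R]_n -> R).
Hypothesis cos_mu : forall xi, \int[mu]_y cos (dotp xi y) = q xi.
Hypothesis sin_mu : forall xi, \int[mu]_y sin (dotp xi y) = 0.
Hypothesis q_ge0 : forall xi, 0 <= q xi.
Local Notation L := (lebesgue_rV R n).

Let q_le1 xi : q xi <= 1.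
Proof.
have muT : fine (mu setT) = 1 by rewrite probability_setT.
rewrite -cos_mu (@le_trans _ _ (\int[mu]_y cst 1 y))//.
  apply: le_Rintegral => //.
  - have := integrable_cos_prob mu xi 0.
    by apply: eq_integrable => // y _ /=; rewrite addr0.
  - exact: finite_measure_integrable_cst.
  - by move=> y _; have := cos_max (dotp xi y); rewrite ler_norml => /andP[].
by rewrite Rintegral_cst// [fine _](_ : _ = 1)// mulr1.
Qed.

Let measurable_q : measurable_fun setT q.
Proof. exact: (measurable_char cos_mu). Qed.

(** Bound the cosine below by one minus its argument in absolute value, at least
    [1 - n%:R * rho * enorm xi]. The main term is kept only on the box, where [q] gives [expR (-1)]
    and the Gaussian weight [expR (- (1 / 2))]; the error term is controlled by [B]. *)
Lemma near_diagonal (p : 'rV[R]_n -> R) (x : 'rV[R]_n) (r rho B : R) :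
  continuous_density mu p -> 0 <= r -> 0 <= rho ->
  (\int[L]_xi (q xi * enorm xi)%:E <= B%:E)%E ->
  (forall xi, box 0 r xi -> expR (-1) <= q xi) ->
  (forall i, `|x 0 i| <= rho) ->
  (pi *+ 2) ^- n * (expR (- (3 / 2)) * (2 * r) ^+ n - n%:R * rho * B) <= p x.
Proof.
move=> pd r0 rho0 qB qr xrho.
have nr0 : 0 <= n%:R * r by rewrite mulr_ge0.
(* Below this threshold [enorm xi * e] is at most 1 on the box, which makes the weight there at
   least [expR (- (1 / 2))]. *)
have e00 : 0 < (n%:R * r + 1)^-1 by rewrite invr_gt0; lra.
apply: (density_ge_gaussian pd e00) => e /andP[e0 ee0].
have s0 : e^-1 != 0 by rewrite gt_eqF// invr_gt0.
rewrite (gaussian_smoothing cos_mu sin_mu)//.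
pose k : R := (pi *+ 2) ^- n.
have k0 : 0 <= k by rewrite invr_ge0 exprn_ge0// mulrn_wge0// pi_ge0.
pose w (xi : 'rV[R]_n) : R := expR (- dotp xi xi / (e^-1 ^+ 2 *+ 2)).
have w1 xi : w xi <= 1.
  rewrite -expR0 ler_expR mulNr oppr_le0 mulr_ge0 ?dotp_ge0// invr_ge0 mulrn_wge0//.
  by rewrite sqr_ge0.
have gE xi : gaussian_rV e^-1 0 xi = normal_peak e^-1 ^+ n * w xi.
  by rewrite gaussian_rVE// subr0.
have wr xi : box 0 r xi -> expR (- (1 / 2)) <= w xi.
  move=> xir; rewrite ler_expR mulNr lerN2.
  have : enorm xi <= n%:R * r.
    by apply: enorm_le_coord => // i; have := xir i; rewrite mxE subr0.
  rewrite -enorm_sqr exprVn => xnr.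
  have xe1 : enorm xi * e <= 1.
    move: ee0; rewrite -[X in _ < X]div1r ltr_pdivlMr; last by lra.
    have := enorm_ge0 xi; nra.
  rewrite [leLHS](_ : _ = (enorm xi * e) ^+ 2 / 2); last first.
    by field; rewrite gt_eqF.
  by rewrite ler_wpM2r// exprn_ile1// mulr_ge0 ?enorm_ge0 ?(ltW e0).
have mE : measurable_fun setT (fun xi => q xi * enorm xi).
  by apply: measurable_funM => //; exact: measurable_enorm.
have iE : L.-integrable setT (EFin \o (fun xi => q xi * enorm xi)).
  apply/integrableP; split; first exact/measurable_EFinP.
  under eq_integral do rewrite /= ger0_norm ?mulr_ge0 ?enorm_ge0//.
  by rewrite (le_lt_trans qB)// ltry.
have iB : L.-integrable setT (EFin \o \1_(box 0 r)).
  apply/integrableP; split.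
    by apply/measurable_EFinP; apply: measurable_indic; exact: measurable_box.
  under eq_integral do rewrite /= ger0_norm//.
  rewrite integral_indic//; last exact: measurable_box.
  by rewrite setIT [X in (X < _)%E](lebesgue_rV_boxE 0 r0) ltry.
have iL : L.-integrable setT (EFin \o (fun xi =>
    expR (- (3 / 2)) * \1_(box 0 r) xi - n%:R * rho * (q xi * enorm xi))).
  have := integrableB measurableT (integrableZl measurableT (expR (- (3 / 2))) iB)
    (integrableZl measurableT (n%:R * rho) iE).
  by apply: eq_integrable.
have iF : L.-integrable setT (EFin \o (fun xi =>
    q xi * cos (dotp xi x) * gaussian_rV e^-1 0 xi)).
  apply: (@le_integrable _ _ _ L setT measurableT _ (EFin \o gaussian_rV e^-1 0)).
  - apply/measurable_EFinP; apply: measurable_funM; last exact: measurable_gaussian_rV.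
    by apply: measurable_funM => //; apply: measurable_cos_comp; exact: measurable_dotp.
  - move=> xi _; rewrite lee_fin normrM ler_piMl// normrM mulr_ile1 ?normr_ge0//.
      by rewrite ger0_norm.
    exact: cos_max.
  - exact: integrable_gaussian_rV.
apply: (@le_trans _ _ (\int[L]_xi (k%:E * (expR (- (3 / 2)) * \1_(box 0 r) xi
    - n%:R * rho * (q xi * enorm xi))%:E)))%E.
  rewrite integralZl//.
  have /fineK <- := integrable_fin_num measurableT iL.
  rewrite -EFinM lee_fin ler_wpM2l// -[leRHS]/(\int[L]_xi (expR (- (3 / 2)) * \1_(box 0 r) xi
    - n%:R * rho * (q xi * enorm xi))).
  rewrite RintegralB//; last 2 first.
  - exact: (integrableZl measurableT (expR (- (3 / 2))) iB).
  - exact: (integrableZl measurableT (n%:R * rho) iE).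
  rewrite !RintegralZl// lerB//.
    rewrite /Rintegral integral_indic//; last exact: measurable_box.
    by rewrite setIT [X in fine X](lebesgue_rV_boxE 0 r0).
  rewrite ler_wpM2l ?mulr_ge0//.
  rewrite -lee_fin fineK//.
  exact: (integrable_fin_num measurableT iE).
apply: le_integral => //.
- exact: (integrableZl measurableT k iL).
- exact: (integrableZl measurableT (normal_peak e ^+ n) iF).
move=> xi _; rewrite -!EFinM lee_fin.
have -> : normal_peak e ^+ n * (q xi * cos (dotp xi x) * gaussian_rV e^-1 0 xi) =
    k * (q xi * w xi * cos (dotp xi x)).
  by rewrite gE /k -exprVn -(normal_peakM_inv e0) exprMn; ring.
rewrite ler_wpM2l//.
have qw0 : 0 <= q xi * w xi by rewrite mulr_ge0 ?expR_ge0.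
apply: (@le_trans _ _ (q xi * w xi * (1 - `|dotp xi x|))); last first.
  by rewrite ler_wpM2l// cos_ge_norm.
rewrite mulrBr mulr1 lerB//.
  rewrite indicE; have [/[!inE] xib|_] := boolP (xi \in _); last by rewrite mulr0.
  rewrite mulr1 (_ : - (3 / 2) = -1 + - (1 / 2)); last by field.
  by rewrite expRD ler_pM ?expR_ge0 ?qr ?wr.
rewrite (le_trans (ler_wpM2l qw0 (dotp_norm_le xi xrho)))//.
rewrite mulrCA ler_wpM2l ?mulr_ge0// ler_wpM2r ?enorm_ge0//.
by rewrite ler_piMr.
Qed.

End near_diagonal.

(** * Chaining *)

Section box_estimates.
Context {R : realType} {n : nat}.
Local Notation L := (lebesgue_rV R n).

Lemma prob_box_ge (mu : probability 'rV[R]_n R) (p : 'rV[R]_n -> R) (z : 'rV[R]_n) (r K : R) :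
  continuous_density mu p -> 0 <= r -> 0 <= K -> (forall y, box z r y -> K <= p y) ->
  ((K * (2 * r) ^+ n)%:E <= mu (box z r))%E.
Proof.
move=> [cp p0 muE] r0 K0 Kp.
rewrite EFinM -(lebesgue_rV_boxE z r0) muE; last exact: measurable_box.
rewrite -integral_cst; last exact: measurable_box.
apply: ge0_le_integral => //.
- exact: measurable_box.
- by apply/measurable_EFinP/measurable_funTS; exact: continuous_measurable_mx.
Qed.

(** If [p z < V], then near [z] the density stays below the midpoint [W], so a small box has too
    little mass. *)
Lemma density_ge_prob_box (mu : probability 'rV[R]_n R) (p : 'rV[R]_n -> R) (z : 'rV[R]_n)
    (r0 V : R) : continuous_density mu p -> 0 < r0 ->
  (forall r, 0 < r <= r0 -> ((V * (2 * r) ^+ n)%:E <= mu (box z r))%E) -> V <= p z.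
Proof.
move=> [cp p0 muE] r00 Hr; rewrite leNgt; apply/negP => pV.
pose W := (p z + V) / 2.
have pW : p z < W by rewrite /W; lra.
have W0 : 0 <= W by rewrite (le_trans (p0 z))// ltW.
have [r rp0 rp] : exists2 r : R, 0 < r & box z r `<=` [set y | p y < W].
  by apply: nbhs_box; exact: (cvgr_lt _ (cp z)).
pose e := Num.min r r0.
have e0 : 0 < e by rewrite lt_min rp0.
have er : e <= r by rewrite ge_min lexx.
have er0 : 0 < e <= r0 by rewrite e0/= ge_min lexx orbT.
have := Hr _ er0; rewrite muE; last exact: measurable_box.
apply/negP; rewrite -ltNge.
apply: (@le_lt_trans _ _ (\int[L]_(y in box z e) (cst W%:E) y)%E).
  apply: ge0_le_integral => //.
  - exact: measurable_box.
  - by move=> y _; rewrite lee_fin.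
  - by apply/measurable_EFinP/measurable_funTS; exact: continuous_measurable_mx.
  - by move=> y ye; rewrite lee_fin ltW//; apply: rp => i; rewrite (le_trans (ye i)).
rewrite integral_cst; last exact: measurable_box.
rewrite [X in (_ * X)%E](lebesgue_rV_boxE z (ltW e0)) -EFinM lte_fin ltr_pM2r.
  by rewrite /W; lra.
by rewrite exprn_gt0// mulr_gt0.
Qed.

Lemma xsection_add_box (x y : 'rV[R]_n) (r : R) :
  xsection [set p : 'rV[R]_n * 'rV[R]_n | box x r (p.1 + p.2)] y = box (x - y) r.
Proof.
have e (v : 'rV[R]_n) i : (y + v) 0 i - x 0 i = v 0 i - (x - y) 0 i.
  by rewrite !mxE; ring.
by apply/seteqP; split => v; rewrite /xsection/= inE/= => H i; have := H i; rewrite e.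
Qed.

Lemma convolution_box (mu1 mu2 : probability 'rV[R]_n R) (x : 'rV[R]_n) (r : R) :
  convolution mu1 mu2 (box x r) = (\int[mu1]_y mu2 (box (x - y) r))%E.
Proof. by apply: eq_integral => y _; rewrite -xsection_add_box. Qed.

Lemma measurable_prob_box (mu : probability 'rV[R]_n R) (x : 'rV[R]_n) (r : R) :
  measurable_fun setT (fun y : 'rV[R]_n => mu (box (x - y) r)).
Proof.
pose A := [set p : 'rV[R]_n * 'rV[R]_n | box x r (p.1 + p.2)].
have mA : measurable A.
  rewrite -[A]setTI.
  apply: (_ : measurable_fun setT (fun p : 'rV[R]_n * 'rV[R]_n => p.1 + p.2)) => //;
    last exact: measurable_box.
  apply: measurable_fun_mx => i j.
  rewrite (_ : (fun _ => _) = (fun p : 'rV[R]_n * 'rV[R]_n => p.1 i j + p.2 i j)); last first.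
    by apply/funext => p; rewrite mxE.
  apply: measurable_funD;
    by apply: (measurableT_comp (f := fun v : 'rV[R]_n => v i j)) => //; exact: measurable_coord.
rewrite (_ : (fun y => _) = mu \o xsection A); first exact: measurable_fun_xsection.
by apply/funext => y /=; rewrite xsection_add_box.
Qed.

(* To reach [box x r] in [m.+2] steps, make the first step into the box of
   radius [b / 2] around [2 x / (m + 2)]: what then remains is within reach of
   [m.+1] steps. *)
Lemma convolution_chain (P : nat -> probability 'rV[R]_n R) (b K : R) :
  0 < b -> 0 <= K ->
  (forall m A, measurable A -> P m.+1 A = convolution (P 0) (P m) A) ->
  (forall (z : 'rV[R]_n) (r : R), 0 <= r -> (forall i, `|z 0 i| + r <= 3 * b) ->
    ((K * (2 * r) ^+ n)%:E <= P 0%N (box z r))%E) ->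
  forall m (z : 'rV[R]_n) (r : R), 0 <= r <= b / 2 -> (forall i, `|z 0 i| <= m.+1%:R * b) ->
    ((K * (K * b ^+ n) ^+ m * (2 * r) ^+ n)%:E <= P m (box z r))%E.
Proof.
move=> b0 K0 PS PK; elim=> [|m IHm] x r /andP[r0 rb] xm.
  rewrite expr0 mulr1; apply: PK => // i; have := xm i; lra.
rewrite PS; last exact: measurable_box.
rewrite convolution_box.
pose z : 'rV[R]_n := \row_i (2 / m.+2%:R * x 0 i).
pose k := K * (K * b ^+ n) ^+ m * (2 * r) ^+ n.
have k0 : 0 <= k by rewrite !mulr_ge0 ?exprn_ge0// mulr_ge0 ?exprn_ge0// ltW.
have m2 : (0 : R) < m.+2%:R by [].
(* The first target box reaches at most [2 * b + b / 2] from 0, within the range [3 * b] of one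
   step. From a point of it, the remaining displacement is at most [m%:R * b + b / 2], within the
   range of the induction hypothesis. *)
have zx i : `|z 0 i| <= 2 * b.
  rewrite mxE normrM ger0_norm// mulrAC ler_pdivrMr//.
  by have := xm i; rewrite -mulrA (mulrC b); nra.
have xz i : `|x 0 i - z 0 i| <= m%:R * b.
  rewrite mxE (_ : _ - _ = (m%:R / m.+2%:R) * x 0 i); last first.
    by rewrite -[m.+2]addn2 natrD; field; rewrite -natrD addn2 gt_eqF.
  rewrite normrM ger0_norm// mulrAC ler_pdivrMr//.
  by rewrite -mulrA (mulrC b) ler_wpM2l.
have zK : ((K * b ^+ n)%:E <= P 0%N (box z (b / 2)))%E.
  have -> : b ^+ n = (2 * (b / 2)) ^+ n by congr (_ ^+ _); field.
  apply: PK => [|i]; first by lra.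
  have := zx i; lra.
apply: (@le_trans _ _ (k%:E * P 0%N (box z (b / 2)))%E).
  apply: le_trans (lee_wpmul2l _ zK); last by rewrite lee_fin.
  by rewrite -EFinM lee_fin /k exprSr; lra.
rewrite -integral_cst; last exact: measurable_box.
apply: (@le_trans _ _ (\int[P 0%N]_(y in box z (b / 2)) P m (box (x - y) r))%E).
  apply: ge0_le_integral => //.
  - exact: measurable_box.
  - by apply: measurable_funTS; exact: measurable_prob_box.
  move=> y yz; apply: IHm; first by rewrite r0.
  move=> i; rewrite !mxE.
  have -> : x 0 i - y 0 i = (x 0 i - z 0 i) - (y 0 i - z 0 i) by ring.
  rewrite (le_trans (ler_normB _ _))//.
  have := xz i; have := yz i; rewrite -[m.+1]addn1 natrD; lra.
apply: ge0_subset_integral => //; first exact: measurable_box.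
exact: measurable_prob_box.
Qed.

End box_estimates.

(** * The scale function *)

(** Since [sup] is 0 on sets without a supremum, a nonzero value certifies a genuine one. It is
    applied to the level sets of [Psi] and, as [1 / t] is nonzero, to the suprema defining [Psi] at
    level points. *)
Lemma has_sup_neq0 (R : realType) (A : set R) : sup A != 0 -> has_sup A.
Proof. by apply: contra_neqP => /sup_out. Qed.

Section levy_exponent.
Context {R : realType} {n : nat} (nu : {measure set 'rV[R]_n -> \bar R}).
Hypothesis nu_levy : symmetric_levy_measure nu.
Local Notation Phi := (levy_exponent nu).

(** The integrand is at most 2 where [enorm y] is at least 1, and quadratic in [y] elsewhere; [C]
    adds up the two constants. *)
Lemma integrable_levy_exponent xi :
  nu.-integrable setT (EFin \o (fun y => 1 - cos (dotp xi y))).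
Proof.
have [_ nu_lty _] := nu_levy.
pose C := 2 + (n%:R * enorm xi) ^+ 2.
have C0 : 0 <= C by rewrite addr_ge0// sqr_ge0.
have m1 : measurable_fun setT (fun y : 'rV[R]_n => Num.min 1 (enorm y ^+ 2)).
  apply: measurable_minr => //; apply: measurable_funX; exact: measurable_enorm.
have mb0 (y : 'rV[R]_n) : 0 <= Num.min 1 (enorm y ^+ 2) by rewrite le_min ler01 sqr_ge0.
have ib : nu.-integrable setT (EFin \o (fun y => Num.min 1 (enorm y ^+ 2))).
  apply/integrableP; split; first exact/measurable_EFinP.
  by under eq_integral do rewrite /= ger0_norm//.
apply: (@le_integrable _ _ _ nu setT measurableT _
   (fun y => C%:E * (Num.min 1 (enorm y ^+ 2))%:E)%E).
- apply/measurable_EFinP; apply: measurable_funB => //.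
  by apply: measurable_cos_comp; exact: measurable_dotp.
- move=> y _; rewrite -EFinM lee_fin [leLHS]ger0_norm ?onem_cos_ge0//.
  rewrite [leRHS]ger0_norm ?mulr_ge0//.
  have [e1|e1] := leP 1 (enorm y ^+ 2).
    by rewrite mulr1 (le_trans (onem_cos_le2 _))// lerDl sqr_ge0.
  rewrite (le_trans (onem_cos_le_sqr _))//.
  have := dotp_norm_le y (coord_le_enorm xi); rewrite dotpC => H.
  have : `|dotp xi y| ^+ 2 <= (n%:R * enorm xi * enorm y) ^+ 2.
    by rewrite lerXn2r ?nnegrE// !mulr_ge0 ?enorm_ge0.
  rewrite real_normK ?num_real// exprMn /C.
  have := sqr_ge0 (n%:R * enorm xi); have := sqr_ge0 (enorm y); nra.
- exact: (integrableZl measurableT C ib).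
Qed.

Lemma levy_exponentM2_le xi : Phi (2 *: xi) <= 4 * Phi xi.
Proof.
rewrite /levy_exponent -RintegralZl//; last exact: integrable_levy_exponent.
apply: le_Rintegral => //.
- exact: integrable_levy_exponent.
- exact: (integrableZl measurableT 4 (integrable_levy_exponent xi)).
move=> y _; rewrite (_ : dotp _ _ = 2 * dotp xi y) ?onem_cosM2_le//.
by rewrite /dotp mulr_sumr; apply: eq_bigr => i _; rewrite mxE mulrA.
Qed.

Lemma levy_exponent_pow2_le k xi : Phi xi <= 4 ^+ k * Phi (2 ^- k *: xi).
Proof.
elim: k => [|k IHk]; first by rewrite !expr0 mul1r invr1 scale1r.
rewrite (le_trans IHk)// exprSr -mulrA ler_wpM2l ?exprn_ge0//.
rewrite (_ : 2 ^- k *: xi = 2 *: (2 ^- k.+1 *: xi)) ?levy_exponentM2_le//.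
by rewrite scalerA exprS invfM mulVKf.
Qed.

Lemma enormZ a (xi : 'rV[R]_n) : 0 <= a -> enorm (a *: xi) = a * enorm xi.
Proof.
move=> a0; rewrite /enorm (_ : dotp _ _ = a ^+ 2 * dotp xi xi).
  by rewrite sqrtrM ?sqr_ge0// sqrtr_sqr ger0_norm.
by rewrite /dotp mulr_sumr; apply: eq_bigr => i _; rewrite !mxE; ring.
Qed.

End levy_exponent.

Section levy_scale.
Context {R : realType} {n : nat} (nu : {measure set 'rV[R]_n -> \bar R}).
Hypothesis nu_levy : symmetric_levy_measure nu.
Hypothesis h_neq0 : forall t, 0 < t -> levy_h nu t != 0.
Local Notation Phi := (levy_exponent nu).
Local Notation Psi := (levy_Psi nu).
Local Notation h := (levy_h nu).
Local Notation level t := [set r | 0 < r /\ Psi r = 1 / t].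

Let Psi_inv_neq0 t : 0 < t -> levy_Psi_inv nu (1 / t) != 0.
Proof. by move=> /h_neq0; rewrite /levy_h div1r invr_eq0. Qed.

Let has_sup_level t : 0 < t -> has_sup (level t).
Proof. by move=> t0; apply: has_sup_neq0; exact: Psi_inv_neq0. Qed.

Let level_exponent t r xi : 0 < t -> level t r -> enorm xi <= r -> Phi xi <= 1 / t.
Proof.
move=> t0 [r0 Pr] xr; rewrite -Pr.
have : has_sup [set Phi z | z in [set z | enorm z <= r]].
  by apply: has_sup_neq0; rewrite -/(Psi r) Pr div1r invr_eq0 gt_eqF.
by move=> [_ /ub_le_sup]; apply; exists xi.
Qed.

Let hV t : (h t)^-1 = levy_Psi_inv nu (1 / t).
Proof. by rewrite /levy_h div1r invrK. Qed.

Lemma levy_h_gt0 t : 0 < t -> 0 < h t.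
Proof.
move=> t0; rewrite -invr_gt0 hV.
have [[r rt] ub] := has_sup_level t0.
by apply: (lt_le_trans rt.1); exact: ub_le_sup.
Qed.

(** The strict inequality leaves a level point beyond [enorm xi], so the supremum need not be
    attained. *)
Lemma levy_exponent_le t xi : 0 < t -> enorm xi < (h t)^-1 -> t * Phi xi <= 1.
Proof.
move=> t0; rewrite hV => /(sup_gt (has_sup_level t0).1)[r rt xr].
rewrite mulrC -ler_pdivlMr//; exact: (level_exponent t0 rt (ltW xr)).
Qed.

(** Take level points [r1] for [t1] and [r2] for [t2]. If [r1 < r2], then [Psi r1 <= Psi r2] while
    [1 / t2 <= 1 / t1], so the two levels agree and [r2] is itself a level point for [t1]. *)
Lemma levy_h_le t1 t2 : 0 < t1 -> t1 <= t2 -> h t1 <= h t2.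
Proof.
move=> t10 t12; have t20 : 0 < t2 by exact: lt_le_trans t12.
rewrite -lef_pV2 ?posrE ?levy_h_gt0// !hV.
have [[r1 r1t] ub1] := has_sup_level t10.
apply: ge_sup; first by have [] := has_sup_level t20.
move=> r2 r2t; have [r21|r12] := leP r2 r1.
  by apply: (le_trans r21); exact: ub_le_sup.
apply: ub_le_sup => //=; split; first exact: r2t.1.
apply/eqP; rewrite r2t.2 eq_le; apply/andP; split.
  by rewrite !div1r lef_pV2.
rewrite -r1t.2; apply: ge_sup.
  by have := @has_sup_neq0 _ _ (_ : Psi r1 != 0) => -[]//; rewrite r1t.2 div1r invr_eq0 gt_eqF.
move=> _ [xi /= xr <-]; apply: (level_exponent t20 r2t).
by rewrite (le_trans xr)// ltW.
Qed.

Let exponent_gt0 : exists xi, 0 < Phi xi.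
Proof.
have [[r [r0 Pr]] _] := has_sup_level ltr01.
apply/not_existsP => H; suff : Psi r <= 0 by rewrite Pr divr1 ler10.
apply: ge_sup.
  by have := @has_sup_neq0 _ _ (_ : Psi r != 0) => -[]//; rewrite Pr divr1 oner_eq0.
by move=> _ [xi _ <-]; rewrite leNgt; apply/negP; exact: H.
Qed.

(** Fix [xi] with [Phi xi > 0], of norm [E], and a level point [r] for [t]. Large [t] forces
    [r < E]. For the least [k] with [E <= 2 ^+ k * r], the vector [2 ^- k *: xi] lies in the ball of
    radius [r], so doubling gives [Phi xi <= 4 ^+ k / t], and minimality gives
    [2 ^+ k * r <= 2 * E]. Hence [r ^+ 2 * (Phi xi * t)] is at most [(2 * E) ^+ 2]. *)
Lemma levy_h_ge_sqrt : exists c t0, [/\ 0 < c, 0 < t0 &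
  forall t, t0 < t -> c * Num.sqrt t <= h t].
Proof.
have [xi P0] := exponent_gt0.
pose E := enorm xi.
have E0 : 0 < E.
  have := enorm_ge0 xi; rewrite le_eqVlt => /orP[/eqP xi0|//].
  suff : Phi xi = 0 by move=> P00; rewrite P00 ltxx in P0.
  rewrite /levy_exponent; under eq_Rintegral => y _.
    have xi_0 i : xi 0 i = 0.
      by apply/eqP; rewrite -normr_le0 xi0 coord_le_enorm.
    rewrite (_ : dotp xi y = 0); last first.
      by rewrite /dotp big1// => i _; rewrite xi_0 mul0r.
    rewrite cos0 subrr; over.
  by rewrite /Rintegral integral0.
exists (Num.sqrt (Phi xi) / (2 * E)), (Phi xi)^-1.
split; first by rewrite divr_gt0 ?sqrtr_gt0 ?mulr_gt0.
  by rewrite invr_gt0.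
move=> t tP; have t0 : 0 < t by apply: lt_trans tP; rewrite invr_gt0.
have tp0 : 0 < Phi xi * t by rewrite mulr_gt0.
rewrite mulrAC -sqrtrM ?(ltW P0)//.
rewrite -lef_pV2 ?posrE ?levy_h_gt0 ?divr_gt0 ?sqrtr_gt0 ?mulr_gt0//.
rewrite hV invf_div.
apply: ge_sup; first by have [] := has_sup_level t0.
move=> r rt; have [r0 _] := rt.
have rE : r < E.
  rewrite ltNge; apply/negP => /(level_exponent t0 rt).
  by apply/negP; rewrite -ltNge div1r invf_plt.
have [k kE kmin] : exists2 k, E <= 2 ^+ k * r & forall j, E <= 2 ^+ j * r -> (k <= j)%N.
  have : exists k, E <= 2 ^+ k * r.
    exists (Num.bound (E / r)); rewrite -ler_pdivrMr//.
    rewrite (le_trans (ltW (archi_boundP (ltW (divr_gt0 E0 r0)))))//.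
    by rewrite -natrX ler_nat ltnW// ltn_expl.
  by move=> H; case: (ex_minnP H) => k; exists k.
case: k => [|k] in kE kmin *.
  by move: kE; rewrite expr0 mul1r leNgt rE.
have {kmin} kr : 2 ^+ k * r < E.
  by rewrite ltNge; apply/negP => /kmin; rewrite ltnn.
have k2 : (0 : R) < 2 ^+ k.+1 by rewrite exprn_gt0.
have : Phi (2 ^- k.+1 *: xi) <= 1 / t.
  apply: (level_exponent t0 rt); rewrite enormZ ?invr_ge0 ?(ltW k2)//.
  by rewrite mulrC ler_pdivrMr// mulrC.
move=> /(ler_wpM2l (exprn_ge0 k.+1 (ler0n R 4))).
move=> /(le_trans (levy_exponent_pow2_le nu_levy k.+1 xi)).
rewrite (_ : 4 = 2 ^+ 2); last by ring.
rewrite -exprM mulnC exprM div1r => Pk.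
have rk : 2 ^+ k.+1 * r <= 2 * E by rewrite exprS -mulrA ler_pM2l// ltW.
have kr0 : 0 <= 2 ^+ k.+1 * r by rewrite ltW// mulr_gt0.
have E20 : 0 <= 2 * E by rewrite ltW// mulr_gt0.
rewrite ler_pdivlMr ?sqrtr_gt0//.
rewrite -(ler_pXn2r (n := 2))// ?nnegrE ?mulr_ge0 ?sqrtr_ge0 ?(ltW r0)//.
rewrite exprMn sqr_sqrtr ?(ltW tp0)// (@le_trans _ _ ((2 ^+ k.+1 * r) ^+ 2))//; last first.
  by rewrite lerXn2r ?nnegrE.
rewrite exprMn mulrC ler_wpM2r ?sqr_ge0//.
by rewrite -ler_pdivlMr.
Qed.

End levy_scale.

(** * The lower bound *)

Section semigroup.
Context {R : realType} {n : nat} (nu : {measure set 'rV[R]_n -> \bar R}).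
Variable P : R -> probability 'rV[R]_n R.
Hypothesis semigroupP : levy_semigroup nu P.
Local Notation Phi := (levy_exponent nu).
Local Notation L := (lebesgue_rV R n).

Lemma levy_semigroup_cos t xi : 0 <= t ->
  \int[P t]_y cos (dotp xi y) = expR (- t * Phi xi).
Proof. by move=> /(levy_semigroup_char semigroupP xi)/(congr1 (@complex.Re R)). Qed.

Lemma levy_semigroup_sin t xi : 0 <= t -> \int[P t]_y sin (dotp xi y) = 0.
Proof. by move=> /(levy_semigroup_char semigroupP xi)/(congr1 (@complex.Im R)). Qed.

Lemma measurable_expR_levy_exponent t : 0 <= t ->
  measurable_fun setT (fun xi => expR (- t * Phi xi)).
Proof.
move=> t0; exact: (measurable_char (fun xi => levy_semigroup_cos xi t0)).
Qed.

(* [levy_Psi_inv] is a supremum, with junk value 0 on empty or unbounded sets;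
   then [levy_h] and its inverse powers are 0 too, so that the integral bound
   would force a positive integrand to vanish.  This replaces the proof that
   [Psi] is continuous and unbounded. *)
Lemma levy_h_neq0 (M0 t : R) : (0 < n)%N -> 0 < t ->
  (\int[L]_xi (expR (- t * Phi xi) * enorm xi)%:E <= (M0 * levy_h nu t ^- n.+1)%:E)%E ->
  levy_h nu t != 0.
Proof.
move=> n0 t0; apply: contraTneq => ->; rewrite expr0n/= invr0 mulr0 -ltNge.
(* The integrand is zero only at the origin. The box of radius [1 / 2] around [z] avoids it and has
   volume 1, so it cannot lie in a null set. *)
pose z : 'rV[R]_n := const_mx 1.
pose f (xi : 'rV[R]_n) := (expR (- t * Phi xi) * enorm xi)%:E.
have f0 xi : (0 <= f xi)%E by rewrite lee_fin mulr_ge0 ?expR_ge0 ?enorm_ge0.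
have mf : measurable_fun setT f.
  apply/measurable_EFinP; apply: measurable_funM; last exact: measurable_enorm.
  by apply: measurable_expR_levy_exponent; exact: ltW.
rewrite lt0e; apply/andP; split; last first.
  by apply: integral_ge0 => xi _; exact: f0.
apply/eqP => If0.
have : (\int[L]_xi `|f xi| = 0)%E.
  by rewrite -If0; apply: eq_integral => xi _; rewrite gee0_abs.
move=> /(ae_eq_integral_abs L measurableT mf)[N [mN LN]] /= zN.
have : (L (box z (1 / 2)) <= L N)%E.
  apply: le_measure; rewrite ?inE//; first exact: measurable_box.
  apply: subset_trans zN => xi zxi /= /(_ Logic.I)[] /eqP.
  rewrite mulf_eq0 gt_eqF ?expR_gt0//= => /eqP xi0.
  have := zxi (Ordinal n0); rewrite mxE.
  have := coord_le_enorm xi (Ordinal n0); rewrite xi0 normr_le0 => /eqP ->.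
  by rewrite sub0r normrN normr1; lra.
rewrite LN lebesgue_rV_boxE; last by lra.
by rewrite lee_fin leNgt exprn_gt0//; lra.
Qed.

End semigroup.

Section lower_bound.
Context {R : realType} {n : nat} (nu : {measure set 'rV[R]_n -> \bar R}).
Hypothesis n_gt0 : (0 < n)%N.
Hypothesis nu_levy : symmetric_levy_measure nu.
Hypothesis h_neq0 : forall t : R, 0 < t -> levy_h nu t != 0.
Variable M0 : R.
Hypothesis M0_gt0 : 0 < M0.
Hypothesis nu_integral : forall t : R, 0 < t ->
  (\int[lebesgue_rV R n]_xi (expR (- t * levy_exponent nu xi) * enorm xi)%:E
   <= (M0 * levy_h nu t ^- n.+1)%:E)%E.
Local Notation h := (levy_h nu).

Lemma levy_near_diagonal : exists a c0 : R, [/\ 0 < a, 0 < c0 &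
  forall (P : R -> probability 'rV[R]_n R) (p : R -> 'rV[R]_n -> R),
    levy_semigroup nu P -> (forall t : R, 0 < t -> continuous_density (P t) (p t)) ->
  forall (t : R) (x : 'rV[R]_n), 0 < t -> (forall i, `|x 0 i| <= a * h t) ->
    c0 * h t ^- n <= p t x].
Proof.
have nR : (0 : R) < n%:R by rewrite ltr0n.
have pi2 : (0 : R) < pi *+ 2 by rewrite pmulrn_lgt0// pi_gt0.
pose w : R := expR (- (3 / 2)) / n%:R ^+ n.
have w0 : 0 < w by rewrite divr_gt0 ?expR_gt0// exprn_gt0.
(* With [r] as below, the main term is [w * h t ^- n]. For [rho = a * h t] the error is
   [n%:R * a * M0 * h t ^- n], and this [a] makes it half of the main term. *)
exists (w / (2 * n%:R * M0)), ((pi *+ 2) ^- n * (w / 2)); split.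
- by rewrite divr_gt0// !mulr_gt0.
- by apply: mulr_gt0; [rewrite invr_gt0 exprn_gt0|rewrite divr_gt0].
move=> P p semiP dens t x t0 xa.
have h0 : 0 < h t by exact: levy_h_gt0.
(* The box of radius [r] then has Euclidean radius at most half of [(h t)^-1], where [t * Phi] is at
   most 1. *)
pose r := (2 * n%:R * h t)^-1.
have d0 : 0 < 2 * n%:R * h t by apply: mulr_gt0 => //; exact: mulr_gt0.
have r0 : 0 <= r by rewrite /r invr_ge0 ltW.
have nd := near_diagonal (fun xi => levy_semigroup_cos semiP xi (ltW t0))
  (fun xi => levy_semigroup_sin semiP xi (ltW t0)) (fun xi => expR_ge0 _) (dens t t0) r0
  (le_trans (normr_ge0 _) (xa (Ordinal n_gt0))) (nu_integral t0) _ xa.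
apply: (le_trans _ (nd _)).
  rewrite -[leLHS]mulrA ler_pM2l ?invr_gt0 ?exprn_gt0//.
  rewrite (_ : (2 * r) ^+ n = (n%:R ^+ n * h t ^+ n)^-1); last first.
    by rewrite -exprMn -exprVn; congr (_ ^+ _); rewrite /r; field; rewrite !gt_eqF.
  rewrite le_eqVlt; apply/orP; left; apply/eqP; rewrite /w exprS.
  by field; rewrite !gt_eqF ?exprn_gt0.
move=> xi xir; rewrite ler_expR mulNr lerN2.
apply: (levy_exponent_le h_neq0 t0).
have : enorm xi <= n%:R * r.
  by apply: enorm_le_coord => // i; have := xir i; rewrite mxE subr0.
move=> /le_lt_trans; apply.
rewrite (_ : n%:R * r = (h t)^-1 / 2); last by rewrite /r; field; rewrite !gt_eqF.
by rewrite ltr_pdivrMr// ltr_pMr ?invr_gt0// ltr1n.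
Qed.

Lemma levy_lower_bound : exists c1 c2 c3 c4 : R,
  [/\ 0 < c1, 0 < c2, 0 < c3 & 0 < c4] /\
  forall (P : R -> probability 'rV[R]_n R) (p : R -> 'rV[R]_n -> R),
    levy_semigroup nu P -> (forall t : R, 0 < t -> continuous_density (P t) (p t)) ->
  forall (t : R) (x : 'rV[R]_n), c3 < t -> enorm x <= c4 * t ->
    c1 * h t ^- n * expR (- c2 * enorm x ^+ 2 / t) <= p t x.
Proof.
have [a [c0 [a0 c00 near]]] := levy_near_diagonal.
have [c [t0 [cp t00 hsqrt]]] := levy_h_ge_sqrt nu_levy h_neq0.
(* Chaining with boxes of scale [b * h tau] needs the one-step bound up to three times that scale,
   which is [a * h tau]. *)
pose b := a / 3.
have b0 : 0 < b by rewrite divr_gt0.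
pose A := ((b * c) ^+ 2)^-1.
have A0 : 0 < A by rewrite invr_gt0 exprn_gt0// mulr_gt0.
pose kappa := c0 * b ^+ n.
have kappa0 : 0 < kappa by rewrite mulr_gt0// exprn_gt0.
(* Chosen so that [expR (- l) <= kappa] and [l > 0], whether or not [kappa] is below 1. *)
pose l := `|ln kappa| + 1.
have l0 : 0 < l by rewrite ltr_wpDl.
have At0 : 0 < (2 * A * t0)^-1 by rewrite invr_gt0 !mulr_gt0.
(* The last constant gives [u <= t / (2 * t0)], so [m%:R * t0 <= t / 2]; together with [2 * t0 < t]
   this yields [m.+1%:R * t0 < t], that is [t0 < tau]. *)
exists c0, (l * A), (2 * t0), (Num.sqrt (2 * A * t0)^-1).
split; first by rewrite c00 !mulr_gt0// sqrtr_gt0 At0.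
move=> P p semiP dens t x ct xt.
have tp : 0 < t by apply: lt_trans ct; rewrite mulr_gt0.
pose X := enorm x.
have X0 : 0 <= X := enorm_ge0 x.
pose u := A * X ^+ 2 / t.
have u0 : 0 <= u by rewrite divr_ge0 ?(ltW tp)// mulr_ge0 ?sqr_ge0// ltW.
(* Both sides of the truncation matter: [u < m.+1%:R] makes [m.+1] steps long enough to reach [x],
   and [m%:R <= u] bounds the loss [kappa ^+ m] by the Gaussian factor. *)
pose m := Num.truncn u.
have /andP[mu um] : m%:R <= u < m.+1%:R by exact: truncn_itv.
have m0 : (0 : R) < m.+1%:R by [].
pose tau := t / m.+1%:R.
have tau0 : 0 < tau by rewrite divr_gt0.
have mtau : m.+1%:R * tau = t by rewrite /tau mulrCA divff ?mulr1// gt_eqF.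
have tau_t : tau <= t by rewrite ler_pdivrMr// ler_peMr ?(ltW tp)// ler1n.
have u_t : u <= t / (2 * t0).
  rewrite /u ler_pdivrMr//.
  have : X ^+ 2 <= (Num.sqrt (2 * A * t0)^-1 * t) ^+ 2.
    have st0 : 0 <= Num.sqrt (2 * A * t0)^-1 * t by rewrite mulr_ge0 ?sqrtr_ge0 ?(ltW tp).
    by apply: lerXn2r => //; rewrite nnegrE.
  rewrite exprMn (sqr_sqrtr (ltW At0)) => /(ler_wpM2l (ltW A0)) /le_trans; apply.
  by rewrite le_eqVlt; apply/orP; left; apply/eqP; field; rewrite !gt_eqF.
have tau_t0 : t0 < tau.
  rewrite ltr_pdivlMr// -natr1 mulrDr mulr1.
  have : t0 * m%:R <= t / 2.
    rewrite (le_trans (ler_wpM2l (ltW t00) (le_trans mu u_t)))//.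
    by rewrite le_eqVlt; apply/orP; left; apply/eqP; field; rewrite gt_eqF.
  by move: ct; lra.
pose H := h tau.
have H0 : 0 < H by exact: levy_h_gt0.
pose be := b * H.
have be0 : 0 < be by rewrite mulr_gt0.
pose K := c0 * H ^- n.
have K0 : 0 < K by rewrite mulr_gt0// invr_gt0 exprn_gt0.
(* The powers of [h tau] cancel: the loss per step depends neither on [t] nor on the number of
   steps. *)
have Kbe : K * be ^+ n = kappa.
  by rewrite /K /be /kappa (exprMn n b H) mulrACA mulVf ?mulr1// expf_neq0// gt_eqF.
have Xm : X <= m.+1%:R * be.
  apply: (@le_trans _ _ (m.+1%:R * (b * (c * Num.sqrt tau)))); last first.
    by rewrite ler_pM2l// ler_pM2l// hsqrt.
  have rhs0 : 0 <= m.+1%:R * (b * (c * Num.sqrt tau)).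
    by apply: mulr_ge0 => //; apply: mulr_ge0 (ltW b0) (mulr_ge0 (ltW cp) (sqrtr_ge0 _)).
  rewrite -(ler_pXn2r (n := 2))// ?nnegrE//.
  rewrite (_ : (_ * _) ^+ 2 = m.+1%:R ^+ 2 * (b * c) ^+ 2 * Num.sqrt tau ^+ 2); last by ring.
  rewrite (sqr_sqrtr (ltW tau0)) (_ : _ * tau = m.+1%:R * t / A); last first.
    by rewrite -mtau /A invrK; ring.
  by rewrite ler_pdivlMr// mulrC -ler_pdivrMr// ltW.
(* [Q k] stands for [k.+1] steps, so [Q m] is [P t]. *)
pose Q (k : nat) := P (k.+1%:R * tau).
have chain := @convolution_chain R n Q be K be0 (ltW K0).
have QS k B : measurable B -> Q k.+1 B = convolution (Q 0%N) (Q k) B.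
  move=> mB; rewrite /Q mul1r.
  have kt0 : 0 <= k.+1%:R * tau by rewrite mulr_ge0 ?(ltW tau0).
  rewrite -(levy_semigroupD semiP (ltW tau0) kt0 mB).
  by congr (P _ B); rewrite -[k.+2%:R]natr1; ring.
have Q0 (z : 'rV[R]_n) (r : R) : 0 <= r -> (forall i, `|z 0 i| + r <= 3 * be) ->
    ((K * (2 * r) ^+ n)%:E <= Q 0%N (box z r))%E.
  move=> r0 zr; rewrite /Q mul1r; apply: (prob_box_ge (dens tau tau0) r0 (ltW K0)).
  move=> y yz; apply: (near P p semiP dens tau y tau0) => i.
  rewrite (_ : a * h tau = 3 * be); last by rewrite /be /b -/H; field.
  rewrite (le_trans _ (zr i))// -lerBlDl (le_trans (lerB_dist _ _))//.
have {}chain := chain QS Q0 m x.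
have Qm : continuous_density (Q m) (p t) by rewrite /Q mtau; exact: dens.
have pK : K * kappa ^+ m <= p t x.
  apply: (density_ge_prob_box (r0 := be / 2) Qm); first by rewrite divr_gt0.
  move=> r /andP[r0 rb]; rewrite -Kbe; apply: chain; first by rewrite ltW.
  by move=> i; rewrite (le_trans (coord_le_enorm x i)).
apply: le_trans pK; apply: ler_pM => //.
- by rewrite mulr_ge0 ?(ltW c00)// invr_ge0 exprn_ge0// ltW// (levy_h_gt0 h_neq0).
- rewrite /K ler_pM2l// lef_pV2 ?posrE ?exprn_gt0 ?(levy_h_gt0 h_neq0)//.
  by rewrite lerXn2r ?nnegrE ?(ltW H0) ?(ltW (levy_h_gt0 h_neq0 tp))// (levy_h_le h_neq0).
have kl : expR (- l) <= kappa.
  rewrite -[leRHS]lnK ?posrE// ler_expR /l opprD.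
  by have := ler_norm (- ln kappa); rewrite normrN; lra.
apply: (@le_trans _ _ (expR (- l) ^+ m)); last first.
  by rewrite lerXn2r ?nnegrE ?expR_ge0 ?(ltW kappa0).
rewrite -expRM_natr ler_expR.
rewrite (_ : - (l * A) * enorm x ^+ 2 / t = - l * u); last first.
  by rewrite !mulNr !mulrA.
by rewrite !mulNr lerN2 ler_pM2l.
Qed.

End lower_bound.

Theorem theorem1p1 (R : realType) (d : nat) (d_gt0 : (0 < d)%N)
    (nu : {measure set 'rV[R]_d -> \bar R})
    (nu_levy : symmetric_levy_measure nu)
    (nu_infinite : nu setT = +oo%E)
    (nu_integral : exists2 M0 : R, 0 < M0 & forall t : R, 0 < t ->
      (\int[lebesgue_rV R d]_xi
         (expR (- t * levy_exponent nu xi) * enorm xi)%:E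
       <= (M0 * levy_h nu t ^- d.+1)%:E)%E) :
  exists c1 c2 c3 c4 : R,
    [/\ 0 < c1, 0 < c2, 0 < c3 & 0 < c4] /\
    forall (P : R -> probability 'rV[R]_d R) (p : R -> 'rV[R]_d -> R),
      levy_semigroup nu P ->
      (forall t : R, 0 < t -> continuous_density (P t) (p t)) ->
      forall (t : R) (x : 'rV[R]_d), c3 < t -> enorm x <= c4 * t ->
        c1 * levy_h nu t ^- d * expR (- c2 * enorm x ^+ 2 / t) <= p t x.
Proof.
have [M0 M00 HM] := nu_integral.
(* A semigroup is at hand to read off the measurability of [levy_exponent nu]
   from its characteristic functions. *)
have [[P [p [semiP dens]]]|noP] := pselect (exists P p, levy_semigroup nu P /\
    forall t : R, 0 < t -> continuous_density (P t) (p t)); last first.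
  (* No pair [P], [p] meets the conditions here, so any positive constants will do. *)
  exists 1, 1, 1, 1; split; first by [].
  by move=> P p semiP dens; case: noP; exists P, p.
have h0 t : 0 < t -> levy_h nu t != 0.
  by move=> t0; exact: (levy_h_neq0 semiP d_gt0 t0 (HM t t0)).
exact: (levy_lower_bound d_gt0 nu_levy h0 M00 HM).
Qed.
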